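(* Let $X = X(Q,\lambda)$ be a retractable toric orbifold of dimension $2n$. Then $X$ has a cell structure with $T$-invariant cells.
   Context: Toric orbifolds. Let $T=\mathbb{R}^n/\mathbb{Z}^n$. Let $Q$ be an $n$-dimensional simple convex polytope in $\mathbb{R}^n$ with set of facets (codimension-one faces) $\mathcal{F}(Q)=\{F_1,\dots,F_d\}$. A characteristic function on $Q$ is a function $\lambda:\mathcal{F}(Q)\to\mathbb{Z}^n$ such that $\lambda(F_{i_1}),\dots,\lambda(F_{i_k})$ are linearly independent primitive vectors whenever $F_{i_1}\cap\dots\cap F_{i_k}\neq\emptyset$; $(Q,\lambda)$ is then called a characteristic pair. A codimension-$k$ face $F$ of $Q$ is the intersection of a unique collection of $k$ facets $F_{i_1},\dots,F_{i_k}$; let $M(F)\subseteq\mathbb{Z}^n$ be the submodule generated by $\lambda(F_{i_1}),\dots,\lambda(F_{i_k})$, let $M(F)_{\mathbb{R}}=M(F)\otimes_{\mathbb{Z}}\mathbb{R}\subseteq\mathbb{R}^n$ be its real span, and let $T_F\subseteq T$ be the image of $M(F)_{\mathbb{R}}$ in $T$, a $k$-dimensional subtorus ($T_Q=1$). The toric orbifold is $X(Q,\lambda)=(T\times Q)/\sim$, where $(t,x)\sim(s,y)$ iff $x=y$ and $s^{-1}t\in T_F$, with $F$ the smallest face of $Q$ containing $x$. $T$ acts by multiplication on the first factor, and the orbit map is $\pi:X(Q,\lambda)\to Q$, $[t,x]\mapsto x$. Local groups. For a codimension-$k$ face $F$ let $M^*(F)=M(F)_{\mathbb{R}}\cap\mathbb{Z}^n$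 and let $\varrho_F:\mathbb{Z}^n\to\mathbb{Z}^n/M^*(F)\cong\mathbb{Z}^{n-k}$ be the projection. Each facet $H$ of $F$ equals $F\cap F_{j}$ for a unique facet $F_{j}$ of $Q$; set $\lambda_F(H)=\mathit{prim}(\varrho_F(\lambda(F_{j})))$, where $\mathit{prim}(x)$ is the primitive vector of which $x$ is a positive integer multiple. (For $F=Q$, $\lambda_Q=\lambda$.) If $v$ is a vertex of $F$, then $v=H_{1}\cap\dots\cap H_{n-k}$ for a unique collection of facets of $F$; the local group is the finite abelian group $G_F(v)=\mathbb{Z}^{n-k}/\langle\lambda_F(H_1),\dots,\lambda_F(H_{n-k})\rangle$. In particular $G_v(v)=\{1\}$. Retraction sequences. Let $m$ be the number of vertices of $Q$; $V(\cdot)$ denotes the vertex set. A retraction sequence of $Q$ is a sequence of triples $\{(B_i,P_i,v_i)\}_{i=1}^m$ constructed as follows. $B_1=P_1=Q$ and $v_1$ is a vertex of $Q$. For $k\ge 2$, $B_k$ is the union of all faces $F$ of $Q$ with $F\subseteq B_{k-1}$ and $v_{k-1}\notin V(F)$; $v_k\in V(B_k)$ is a vertex having a neighbourhood $U_k$ in $B_k$ homeomorphic, as a manifold with corners, to $\mathbb{R}^{s_k}_{\geq}$ ($=[0,\infty)^{s_k}$) for some $0\le s_k\le\dim B_k$ (such a $v_k$ is called a free vertex of $B_k$); $P_k$ is the smallest face of $B_k$ containing $U_k$, and $U_k$ is obtained from $P_k$ by deleting all its faces not containing $v_k$. The sequence is required to end with $B_m=P_m=\{v_m\}$ a vertex.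 Retractable. $X(Q,\lambda)$ is retractable if $Q$ has a retraction sequence $\{(B_i,P_i,v_i)\}_{i=1}^m$ such that $G_{P_i}(v_i)$ is trivial for $i=1,\dots,m-1$. Cell structure. Here a cell structure with $T$-invariant cells means a decomposition of $X$ into finitely many pairwise disjoint $T$-invariant subspaces, each homeomorphic to an open disc of some dimension (it is not required to be a CW structure). *)

(* Defs.v *)
From HB Require Import structures.
From mathcomp Require Import all_boot all_order all_algebra.
From mathcomp Require Import generic_quotient ring_quotient.
From mathcomp Require Import all_classical all_reals all_analysis.

Set Implicit Arguments.
Unset Strict Implicit.
Unset Printing Implicit Defensive.

Import Order.TTheory GRing.Theory Num.Theory.
Import numFieldNormedType.Exports.

Local Open Scope classical_set_scope.
Local Open Scope ring_scope.
Local Open Scope quotient_scope.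

Section AbelianGroups.
Context {V : zmodType}.

Definition is_subgroup (H : set V) : Prop :=
  H 0 /\ forall x y, H x -> H y -> H (x - y).

Definition gen_subgroup (A : set V) : set V := smallest is_subgroup A.

Definition gen_pred (A : set V) : {pred V} := fun x => `[< gen_subgroup A x >].

Lemma gen_pred_zmod_closed (A : set V) : zmod_closed (gen_pred A).
Proof.
split=> [|x y /asboolP Hx /asboolP Hy]; apply/asboolP => H [sH AH].
  exact: sH.1.
by apply: sH.2; [exact: Hx | exact: Hy].
Qed.

HB.instance Definition _ (A : set V) :=
  GRing.isZmodClosed.Build V (gen_pred A) (gen_pred_zmod_closed A).

(* V / <A>; this is V / A when A is already a subgroup. *)
Definition quotient_group (A : set V) : zmodType :=
  Quotient.quot (gen_pred A : zmodClosed V).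

Definition quotient_proj (A : set V) (x : V) : quotient_group A :=
  \pi_(Quotient.quot (gen_pred A : zmodClosed V)) x.

Definition primitive (y : V) : Prop :=
  forall (z : V) (k : nat), y = z *+ k -> k = 1%N.

(* The default value 0 is irrelevant: in a lattice every nonzero vector is a
   positive multiple of a unique primitive one. *)
Definition prim (x : V) : V :=
  xget 0 [set y | primitive y /\ exists2 k : nat, (0 < k)%N & x = y *+ k].

End AbelianGroups.

Section Polytopes.
Context {R : realType} {n : nat}.
Implicit Types (P Q F G H A : set 'rV[R]_n) (v : 'rV[R]_n).

Definition dotv (u v : 'rV[R]_n) : R := \sum_i u 0 i * v 0 i.

Definition polytope P : Prop :=
  bounded_set P /\
  exists (k : nat) (N : 'I_k -> 'rV[R]_n) (b : 'I_k -> R),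
    P = [set x | forall i, dotv (N i) x <= b i].

(* The affine hull of A has dimension k: A contains k + 1 affinely independent
   points, namely x0 and the x0 + row i M, whose affine hull contains A. *)
Definition aff_dim A (k : nat) : Prop :=
  exists (x0 : 'rV[R]_n) (M : 'M[R]_(k, n)),
    [/\ A x0, row_free M, forall i, A (x0 + row i M)
      & forall x, A x -> (x - x0 <= M)%MS].

(* Faces are nonempty; P is a face of itself. *)
Definition face P F : Prop :=
  F !=set0 /\
  exists (c : 'rV[R]_n) (b : R),
    (forall x, P x -> dotv c x <= b) /\ F = P `&` [set x | dotv c x = b].

Definition facet P H : Prop :=
  face P H /\ exists2 k : nat, aff_dim P k.+1 & aff_dim H k.

Definition vertices P : set 'rV[R]_n := [set v | face P [set v]].

Definition simple_polytope Q : Prop :=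
  [/\ polytope Q, aff_dim Q n
    & forall v, vertices Q v -> ([set F | facet Q F /\ F v] #= `I_n)%card].

Definition min_face Q v : set 'rV[R]_n := smallest (face Q) [set v].

End Polytopes.

Definition homeo_on {X Y : topologicalType} (A : set X) (B : set Y)
    (f : X -> Y) (g : Y -> X) : Prop :=
  [/\ set_fun A B f, set_fun B A g,
      (forall x, A x -> g (f x) = x) /\ (forall y, B y -> f (g y) = y),
      {within A, continuous f} & {within B, continuous g}].

Definition homeomorphic {X Y : topologicalType} (A : set X) (B : set Y) : Prop :=
  exists f g, homeo_on A B f g.

Section CharacteristicPairs.
Context {R : realType} {n : nat}.
Variables (Q : set 'rV[R]_n) (lambda : set 'rV[R]_n -> 'rV[int]_n).
Implicit Types (F G H : set 'rV[R]_n) (v : 'rV[R]_n).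

(* Only the values of lambda at the facets of Q matter, here and below.  The
   facets F i are distinct, and k = 0 is vacuous. *)
Definition characteristic_function : Prop :=
  forall (k : nat) (F : 'I_k -> set 'rV[R]_n),
    injective F -> (forall i, facet Q (F i)) -> \bigcap_i F i !=set0 ->
    (forall c : 'I_k -> int, \sum_i c i *: lambda (F i) = 0 -> forall i, c i = 0)
    /\ (forall i, primitive (lambda (F i))).

Definition intv (z : 'rV[int]_n) : 'rV[R]_n := map_mx intr z.

Definition real_span (S : set 'rV[int]_n) : set 'rV[R]_n :=
  [set u | exists (k : nat) (c : 'I_k -> R) (z : 'I_k -> 'rV[int]_n),
     (forall i, S (z i)) /\ u = \sum_i c i *: intv (z i)].

(* As Q is simple, the facets containing F are exactly the members of the
   unique collection of codim F facets with intersection F. *)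
Definition M_of F : set 'rV[int]_n :=
  gen_subgroup (lambda @` [set G | facet Q G /\ F `<=` G]).

Definition M_real F : set 'rV[R]_n := real_span (M_of F).

Definition M_star F : set 'rV[int]_n := [set z | M_real F (intv z)].

Definition face_lattice F : zmodType := quotient_group (M_star F).

Definition rho F (z : 'rV[int]_n) : face_lattice F := quotient_proj (M_star F) z.

(* The unique facet of Q meeting F exactly in its facet H. *)
Definition facet_cutting F H : set 'rV[R]_n :=
  xget set0 [set G | facet Q G /\ H = F `&` G].

Definition lambda_face F H : face_lattice F :=
  prim (rho F (lambda (facet_cutting F H))).

Definition local_group F v : zmodType :=
  quotient_group (lambda_face F @` [set H | facet F H /\ H v]).

End CharacteristicPairs.

Section Torus.
Variables (R : realType) (n : nat).

Definition integer_points : set 'rV[R]_n := range intv.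

Definition torus : Type :=
  quotient_topology (Quotient.quot (gen_pred integer_points : zmodClosed 'rV[R]_n)).

HB.instance Definition _ := Topological.on torus.
HB.instance Definition _ := GRing.Zmodule.copy torus
  (Quotient.quot (gen_pred integer_points : zmodClosed 'rV[R]_n)).

Definition torus_proj (x : 'rV[R]_n) : torus :=
  \pi_(Quotient.quot (gen_pred integer_points : zmodClosed 'rV[R]_n)) x.

End Torus.

Section ToricOrbifold.
Context {R : realType} {n : nat}.
Variables (Q : set 'rV[R]_n) (lambda : set 'rV[R]_n -> 'rV[int]_n).
Local Notation T := (torus R n).

Definition subtorus (F : set 'rV[R]_n) : set T :=
  [set torus_proj u | u in M_real Q lambda F].

Lemma real_span_subgroup (S : set 'rV[int]_n) :
  is_subgroup (real_span S : set 'rV[R]_n).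
Proof.
split.
  by exists 0%N, (fun=> 0), (fun=> 0); split=> [[]//|]; rewrite big_ord0.
move=> _ _ [k [c [z [Sz ->]]]] [l [d [w [Sw ->]]]].
exists (k + l)%N.
exists (fun i : 'I_(k + l) =>
  match fintype.split i with inl j => c j | inr j => - d j end).
exists (fun i : 'I_(k + l) =>
  match fintype.split i with inl j => z j | inr j => w j end).
split=> [i|]; first by case: (fintype.split i).
rewrite big_split_ord /=; congr (_ + _).
  by apply: eq_bigr => i _; rewrite (unsplitK (inl i)).
rewrite -sumrN; apply: eq_bigr => i _.
by rewrite (unsplitK (inr i)) scaleNr.
Qed.

Lemma subtorus_subgroup (F : set 'rV[R]_n) : is_subgroup (subtorus F).
Proof.
have [M0 MB] := real_span_subgroup (M_of Q lambda F).
split.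
  by exists 0 => //; rewrite /torus_proj piE.
move=> _ _ [u Mu <-] [w Mw <-]; exists (u - w); first exact: MB.
by rewrite /torus_proj; symmetry; rewrite !piE.
Qed.

Definition orbit_rel : rel (T * set_type Q) := fun p q =>
  `[< p.2 = q.2 /\ subtorus (min_face Q (set_val p.2)) (p.1 - q.1) >].

Lemma orbit_rel_equiv : equiv_class_of orbit_rel.
Proof.
have sT F := subtorus_subgroup F.
split=> [[t x]|[t x] [s y]|[s y] [t x] [r z]]; rewrite /orbit_rel /=.
- by apply/asboolP; split=> //; rewrite subrr; exact: (sT _).1.
- by apply/asboolP/asboolP => -[-> st]; split=> //;
    rewrite -opprB -sub0r; apply: (sT _).2 => //; exact: (sT _).1.
- move=> /asboolP[<- ts] /asboolP[<- sr]; apply/asboolP; split=> //.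
  rewrite -(subrKA s) -[s - r]opprK; apply: (sT _).2 => //.
  by rewrite -sub0r; apply: (sT _).2 => //; exact: (sT _).1.
Qed.

Canonical orbit_rel_equiv_rel := EquivRelPack orbit_rel_equiv.
Canonical orbit_rel_encModRel := defaultEncModRel orbit_rel.

Definition toric_orbifold : topologicalType :=
  quotient_topology {eq_quot orbit_rel}.

Definition toric_proj (p : T * set_type Q) : toric_orbifold :=
  \pi_(quotient_topology {eq_quot orbit_rel}) p.

Definition toric_repr (p : toric_orbifold) : T * set_type Q :=
  repr (p : quotient_topology {eq_quot orbit_rel}).

Definition torus_act (t : T) (p : toric_orbifold) : toric_orbifold :=
  toric_proj (t + (toric_repr p).1, (toric_repr p).2).

Lemma torus_actE (t s : T) (x : set_type Q) :
  torus_act t (toric_proj (s, x)) = toric_proj (t + s, x).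
Proof.
have : toric_proj (toric_repr (toric_proj (s, x))) = toric_proj (s, x).
  by rewrite /toric_proj /toric_repr reprK.
rewrite /torus_act; case: (toric_repr _) => r y /=.
move=> /(@eqquotP _ orbit_rel_equiv_rel) /asboolP /= [-> rs].
apply/(@eqquotP _ orbit_rel_equiv_rel)/asboolP; split=> //=.
by rewrite opprD addrACA subrr add0r.
Qed.

Definition invariant (A : set toric_orbifold) : Prop :=
  forall t p, A p -> A (torus_act t p).

Definition open_disc (d : nat) : set 'rV[R]_d := [set x | dotv x x < 1].

Definition invariant_cell_structure : Prop :=
  exists (N : nat) (cell : 'I_N -> set toric_orbifold),
    [/\ forall i, invariant (cell i),
        forall i, exists d : nat, homeomorphic (cell i) (@open_disc d),
        trivIset setT cell
      & \bigcup_i cell i = setT].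

End ToricOrbifold.

Section Retraction.
Context {R : realType} {n : nat}.
Variable Q : set 'rV[R]_n.
Implicit Types (B P U : set 'rV[R]_n) (v : 'rV[R]_n).

(* In this section B is a union of faces of Q; its faces are the faces of Q
   that it contains. *)

Definition faces_of B : set (set 'rV[R]_n) := [set F | face Q F /\ F `<=` B].

Definition complex_dim B (d : nat) : Prop :=
  (exists2 F, faces_of B F & aff_dim F d) /\
  (forall F e, faces_of B F -> aff_dim F e -> (e <= d)%N).

Definition orthant (s : nat) : set 'rV[R]_s := [set x | forall i, 0 <= x 0 i].

Definition orthant_face (s : nat) (I : {set 'I_s}) : set 'rV[R]_s :=
  @orthant s `&` [set x | forall i, i \in I -> x 0 i = 0].

(* A homeomorphism of manifolds with corners: it matches the traces on U of the
   faces of B with the faces of the orthant. *)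
Definition corner_homeomorphic B U (s : nat) : Prop :=
  exists f g, homeo_on U (@orthant s) f g /\
    [set f @` (F `&` U) | F in [set F | faces_of B F /\ F `&` U !=set0]]
      = range (@orthant_face s).

Definition free_vertex_nbhd B v U (s : nat) : Prop :=
  [/\ B v /\ vertices Q v,
      U `<=` B /\ within B (nbhs v) U,
      exists2 d, complex_dim B d & (s <= d)%N
    & corner_homeomorphic B U s].

(* Triples are indexed by 1, ..., m. *)
Record retraction_sequence (m : nat) (B P : nat -> set 'rV[R]_n)
    (v : nat -> 'rV[R]_n) : Prop := RetractionSequence {
  retr_card : (vertices Q #= `I_m)%card;
  retr_start : [/\ B 1%N = Q, P 1%N = Q & vertices Q (v 1%N)];
  retr_B : forall k, (1 < k <= m)%N ->
    B k = \bigcup_(F in [set F | faces_of (B k.-1) F /\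
                                 ~ vertices F (v k.-1)]) F;
  retr_P : forall k, (1 < k <= m)%N ->
    exists (U : set 'rV[R]_n) (s : nat),
      [/\ free_vertex_nbhd (B k) (v k) U s,
          faces_of (B k) (P k) /\ U `<=` P k,
          forall F, faces_of (B k) F -> U `<=` F -> P k `<=` F
        & U = P k `\` \bigcup_(F in [set F | face (P k) F /\ ~ F (v k)]) F];
  retr_end : B m = [set v m] /\ P m = [set v m] }.

Definition retractable (lambda : set 'rV[R]_n -> 'rV[int]_n) : Prop :=
  exists (m : nat) (B P : nat -> set 'rV[R]_n) (v : nat -> 'rV[R]_n),
    retraction_sequence m B P v /\
    forall i, (1 <= i < m)%N ->
      forall g : local_group Q lambda (P i) (v i), g = 0.

End Retraction.

(* Main.v *)
Require Import Defs.
From mathcomp Require Import all_boot all_order all_algebra.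
From mathcomp Require Import generic_quotient ring_quotient.
From mathcomp Require Import all_classical all_reals all_analysis.
From mathcomp Require Import lra ring.

(** Let [v] be a vertex of the face [P] of the simple polytope [Q], of
    dimension [s], and let [U] be the open star of [v] in [P], that is [P]
    without its faces missing [v]. If the local group of [P] at [v] is
    trivial, then the part of the orbifold over [U] is an open disc of
    dimension [2 s].

    Indeed there are affine coordinates at [v], the slacks of the [n]
    constraints tight at [v], in which [Q] is [{y >= 0 and L_j . y <= 1 for
    all j}] and the facets through [v] are the walls [y_i = 0]
    ([exists_vertex_chart]); [P] is given by the vanishing of the coordinates
    outside of some set [I] of [s] indices ([face_coord_face]), and [U] by the
    further condition [L_j . y < 1 for all j] ([open_starE]). On the side of
    the torus, the characteristic vectors of the facets through [v] form a
    basis of the real vector space; triviality of the local group says that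
    suitable multiples of the coordinates of index in [I] identify the lattice
    of [P], a quotient of the integral vectors, with the integral vectors of
    dimension [s] ([angular_coordinates]). So the points over [U] are
    described by the squared moduli [y_i] and the angles, [i] in [I], where
    the [i]-th angle disappears exactly when [y_i = 0]: they are the points of
    complex space of dimension [s] whose squared moduli satisfy [L_j . y < 1].
    This domain is star-shaped and [Q] is bounded, so a radial map carries it
    to the open unit ball ([continuous_radial]).

    The topology needs care in both directions, because [U] need not be open
    in [Q] and the orbifold is a quotient. The polar map extends continuously
    to the whole orbifold when it is multiplied by the product of the [1 - L_j
    . y] ([weighted_wave]). Its inverse is continuous in the angles and the
    moduli together, and the angles of a point can be taken in a compact cube,
    where [continuous_unroll_angles] concludes.

    Finally the stage [B_i] of a retraction sequence minus the stage [B_{i+1}]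
    is the open star of [v_i] in [P_i] ([retraction_next]), so these stars
    partition [Q]; the cells are their preimages. At the last stage, [P_m] is
    reduced to [v_m] and the local group is trivial, because the lattice of a
    vertex is 0 ([vertex_local_group]). *)

Set Implicit Arguments.
Unset Strict Implicit.
Unset Printing Implicit Defensive.

Import Order.TTheory GRing.Theory Num.Theory.
Import numFieldNormedType.Exports.

Local Open Scope classical_set_scope.
Local Open Scope ring_scope.
Local Open Scope quotient_scope.

(** * Linear functionals *)

Section DotProduct.
Context {R : realType} {n : nat}.
Implicit Types (u v w : 'rV[R]_n) (a : R).

Lemma dotvE u v : dotv u v = (u *m v^T) 0 0.
Proof. by rewrite /dotv mxE; apply: eq_bigr => i _; rewrite mxE. Qed.

Lemma dotvC u v : dotv u v = dotv v u.
Proof. by apply: eq_bigr => i _; rewrite mulrC. Qed.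

Lemma dotvDr u v w : dotv u (v + w) = dotv u v + dotv u w.
Proof. by rewrite !dotvE linearD mulmxDr mxE. Qed.

Lemma dotvDl u v w : dotv (v + w) u = dotv v u + dotv w u.
Proof. by rewrite !dotvE mulmxDl mxE. Qed.

Lemma dotvZr u a v : dotv u (a *: v) = a * dotv u v.
Proof. by rewrite !dotvE linearZ -scalemxAr mxE. Qed.

Lemma dotvZl u a v : dotv (a *: v) u = a * dotv v u.
Proof. by rewrite !dotvE -scalemxAl mxE. Qed.

Lemma dotvNr u v : dotv u (- v) = - dotv u v.
Proof. by rewrite -scaleN1r dotvZr mulN1r. Qed.

Lemma dotvBr u v w : dotv u (v - w) = dotv u v - dotv u w.
Proof. by rewrite dotvDr dotvNr. Qed.

Lemma dotv0r u : dotv u 0 = 0.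
Proof. by rewrite -(scale0r 0) dotvZr mul0r. Qed.

Lemma dotv0l u : dotv 0 u = 0.
Proof. by rewrite -(scale0r 0) dotvZl mul0r. Qed.

Lemma dotv_sumr u (I : Type) (r : seq I) (P : pred I) (F : I -> 'rV[R]_n) :
  dotv u (\sum_(i <- r | P i) F i) = \sum_(i <- r | P i) dotv u (F i).
Proof.
by elim/big_rec2: _ => [|i x y _ <-]; [exact: dotv0r | rewrite dotvDr].
Qed.

Lemma dotv_mulmx u v (A : 'M[R]_n) : dotv u (v *m A) = dotv (u *m A^T) v.
Proof. by rewrite !dotvE trmx_mul mulmxA. Qed.

End DotProduct.

(** One scale that works for finitely many strict inequalities at once: it is
    how a point is moved a little without leaving a polytope. *)
Lemma small_scale {R : realType} (T : finType) (c d : T -> R) :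
  (forall i, 0 < d i) -> exists2 e, 0 < e & forall i, e * `|c i| < d i.
Proof.
move=> d0; pose S := 1 + \sum_i `|c i| / d i.
have t0 i : 0 <= `|c i| / d i by rewrite divr_ge0// ltW.
have S0 : 0 < S by rewrite ltr_pwDl// sumr_ge0.
exists S^-1; first by rewrite invr_gt0.
move=> i; rewrite mulrC ltr_pdivrMr// -ltr_pdivrMl// mulrC /S (bigD1 i)//=.
by rewrite addrCA ltrDl ltr_pwDl// sumr_ge0.
Qed.

(** * Facets at a vertex of a simple polytope *)

Section Presentations.
Context {R : realType} {n : nat}.
Implicit Types (Q : set 'rV[R]_n) (x v : 'rV[R]_n).

Lemma vertex_in Q v : vertices Q v -> Q v.
Proof.
move=> [_ [c [a [_ e]]]].
by have [] : (Q `&` [set x | dotv c x = a]) v by rewrite -e.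
Qed.

Definition halfspaces k (N : 'I_k -> 'rV[R]_n) (b : 'I_k -> R) : set 'rV[R]_n :=
  [set x | forall i, dotv (N i) x <= b i].

Definition irredundant k (N : 'I_k -> 'rV[R]_n) (b : 'I_k -> R) : Prop :=
  forall j, exists2 x, b j < dotv (N j) x &
    forall i, i != j -> dotv (N i) x <= b i.

(** A presentation with the fewest constraints is irredundant, since a
    redundant constraint could be dropped. *)
Lemma irredundant_presentation Q : polytope Q ->
  exists k (N : 'I_k -> 'rV[R]_n) (b : 'I_k -> R),
    Q = halfspaces N b /\ irredundant N b.
Proof.
move=> [_ [k0 [N0 [b0 Q0]]]].
pose pres k := `[< exists (N : 'I_k -> 'rV[R]_n) b, Q = halfspaces N b >].
have ex : exists k, pres k by exists k0; apply/asboolP; exists N0, b0.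
case: (ex_minnP ex) => k /asboolP[N [b QE]] kmin.
exists k, N, b; split=> //.
case: k N b QE kmin => [|k] N b QE kmin j; first by case: j.
apply: contrapT => nj.
suff /kmin : pres k by rewrite ltnn.
apply/asboolP; exists (N \o lift j), (b \o lift j).
rewrite QE; apply/seteqP; split=> x Hx i; first exact: Hx.
have [->|ij] := eqVneq i j; last first.
  case: (unliftP j i) ij => [i' ->|-> /eqP//] _; exact: Hx.
rewrite leNgt; apply/negP => bj; apply: nj; exists x => // l.
by rewrite eq_sym => /unlift_some[l' -> _]; exact: Hx.
Qed.

Section FixedPresentation.
Variables (k : nat) (N : 'I_k -> 'rV[R]_n) (b : 'I_k -> R).
Hypotheses (irr : irredundant N b) (full : aff_dim (halfspaces N b) n).
Let Q := halfspaces N b.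

Lemma normal_neq0 j : N j != 0.
Proof.
have [x0 [M [Qx0 _ _ _]]] := full; have [x bx _] := irr j.
apply/eqP => Nj0; have := Qx0 j; move: bx; rewrite Nj0 !dotv0l => b0 b1.
by have := lt_le_trans b0 b1; rewrite ltxx.
Qed.

(** The average of the affinely independent points spanning the polytope: a
    constraint that is tight at the average is tight at all of them, so its
    normal vanishes. *)
Lemma interior_point : exists x, forall j, dotv (N j) x < b j.
Proof.
have [p [M [Qp Mfree QM _]]] := full.
exists (p + n.+1%:R^-1 *: \sum_i row i M) => j.
rewrite ltNge; apply/negP => bj.
pose a0 := b j - dotv (N j) p.
pose a i := b j - dotv (N j) (p + row i M).
have a00 : 0 <= a0 by rewrite subr_ge0.
have a_ge0 i : 0 <= a i by rewrite subr_ge0; exact: QM.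
have n0 : n.+1%:R != 0 :> R by rewrite pnatr_eq0.
have suma : a0 + \sum_i a i <= 0.
  have -> : a0 + \sum_i a i =
      n.+1%:R * (b j - dotv (N j) (p + n.+1%:R^-1 *: \sum_i row i M)).
    rewrite /a0 /a sumrB sumr_const card_ord.
    under eq_bigr do rewrite dotvDr.
    rewrite big_split/= sumr_const card_ord dotvDr dotvZr dotv_sumr.
    rewrite mulrBr mulrDr mulVKf// -[in RHS]natr1 !mulrDl !mul1r.
    rewrite -[b j *+ n]mulr_natl -[dotv _ p *+ n]mulr_natl.
    ring.
  by rewrite mulr_ge0_le0// subr_le0.
have S0 : 0 <= \sum_i a i by exact: sumr_ge0.
have {}a00 : a0 = 0 by lra.
have {}S0 : \sum_i a i = 0 by lra.
have ai0 i : a i = 0 by apply: (psumr_eq0P _ S0) => // l _.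
have Nrow i : dotv (N j) (row i M) = 0.
  by have := ai0 i; rewrite /a dotvDr; move: a00; rewrite /a0; lra.
have /negP[] := normal_neq0 j; apply/eqP/trmx_inj; rewrite trmx0.
have: M *m (N j)^T = 0.
  apply/matrixP => i l; rewrite [l]ord1 !mxE -[RHS](Nrow i) /dotv.
  by apply: eq_bigr => h _; rewrite !mxE mulrC.
move: Mfree; rewrite row_free_unit => Mu /(congr1 (mulmx (invmx M))).
by rewrite mulKmx// mulmx0.
Qed.

(** The segment from an interior point to a point violating only constraint
    [j] crosses the hyperplane of [j] where all the other constraints are
    strict. *)
Lemma facet_point j :
  exists2 x, dotv (N j) x = b j & forall i, i != j -> dotv (N i) x < b i.
Proof.
have [x0 x0lt] := interior_point; have [x1 x1gt x1le] := irr j.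
have l0 := x0lt j.
pose t := (b j - dotv (N j) x0) / (dotv (N j) x1 - dotv (N j) x0).
have d0 : 0 < dotv (N j) x1 - dotv (N j) x0 by lra.
have t0 : 0 < t by rewrite divr_gt0// subr_gt0.
have t1 : t < 1 by rewrite ltr_pdivrMr// mul1r ltrD2r.
exists (x0 + t *: (x1 - x0)) => [|i ij].
  by rewrite dotvDr dotvZr dotvBr /t divfK ?gt_eqF// addrC subrK.
rewrite dotvDr dotvZr dotvBr; have := x0lt i; have := x1le i ij; nra.
Qed.

(** Near the point of [facet_point], the polytope is cut out by one constraint
    only, so a small simplex spanning the hyperplane fits in the face. *)
Lemma facet_constraint j : facet Q (Q `&` [set x | dotv (N j) x = b j]).
Proof.
have [x xj xi] := facet_point j.
have Qx : Q x.
  move=> i; have [->|/xi/ltW//] := eqVneq i j; by rewrite xj.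
split; first split; first by exists x.
  by exists (N j), (b j); split.
pose K := kermx (N j)^T; pose B := row_base K.
have rkK : n = (\rank K).+1.
  have n0 : (0 < n)%N.
    rewrite lt0n; apply/eqP => n0; case/eqP: (normal_neq0 j).
    by apply/rowP => -[i i0]; exfalso; move: i0; rewrite n0.
  rewrite /K mxrank_ker mxrank_tr rank_rV normal_neq0/=.
  by rewrite subn1 prednK.
have NB i : dotv (N j) (row i B) = 0.
  have : (row i B <= K)%MS by rewrite (submx_trans (row_sub _ _))// eq_row_base.
  by move=> /sub_kermxP e; rewrite dotvE -[_ *m _]trmxK trmx_mul trmxK e !mxE.
pose d (p : 'I_(\rank K) * 'I_k) :=
  if p.2 == j then 1 else b p.2 - dotv (N p.2) x.
have [p|e e0 He] := small_scale (fun p => dotv (N p.2) (row p.1 B)) (d := d).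
  by rewrite /d; case: ifPn => // /xi; rewrite subr_gt0.
exists (\rank K); first by rewrite -rkK.
exists x, (e *: B); split=> //.
- by rewrite /row_free (mxrank_scale_nz _ (lt0r_neq0 e0)); exact: row_base_free.
- move=> i; rewrite linearZ/=; split=> [l|] /=; rewrite dotvDr dotvZr;
    last by rewrite NB mulr0 addr0.
  have [->|lj] := eqVneq l j; first by rewrite NB mulr0 addr0 xj.
  have := He (i, l); rewrite /d/= (negbTE lj) => {}He.
  rewrite -lerBrDl (le_trans _ (ltW He))//.
  by rewrite ler_wpM2l ?ler_norm// ltW.
- move=> z [_ /= Nz]; rewrite (eqmx_scale _ (lt0r_neq0 e0)) eq_row_base.
  apply/sub_kermxP/matrixP => i l; rewrite !ord1 -dotvE dotvC dotvBr.
  by rewrite Nz xj subrr mxE.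
Qed.

(** A direction annihilated by all the constraints tight at [v] can be
    followed both ways inside the polytope, which no face reduced to [v]
    allows. *)
Lemma vertex_normals_span v u : vertices Q v ->
  (forall j, dotv (N j) v = b j -> dotv (N j) u = 0) -> u = 0.
Proof.
move=> [_ [c [a [ca vE]]]] uN.
have [Qv cv] : (Q `&` [set x | dotv c x = a]) v by rewrite -vE.
pose d j := if dotv (N j) v == b j then 1 else b j - dotv (N j) v.
have [j|e e0 He] := small_scale (fun j => dotv (N j) u) (d := d).
  rewrite /d; case: ifPn => // ne; rewrite subr_gt0 lt_neqAle ne; exact: Qv.
have Qe s : `|s| = e -> Q (v + s *: u).
  move=> se j; rewrite dotvDr dotvZr.
  have [/eqP/[dup] vj ->|ne] := boolP (dotv (N j) v == b j).
    by rewrite uN// mulr0 addr0.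
  have := He j; rewrite /d (negbTE ne) => {}He.
  rewrite -lerBrDl (le_trans _ (ltW He))//.
  by rewrite -se -normrM ler_norm.
have /ca : Q (v + e *: u) by apply: Qe; rewrite gtr0_norm.
have /ca : Q (v + (- e) *: u) by apply: Qe; rewrite normrN gtr0_norm.
rewrite !dotvDr !dotvZr cv => /= c1 c2.
have ceu : e * dotv c u = 0 by lra.
have : [set v] (v + e *: u).
  rewrite vE; split; first by apply: Qe; rewrite gtr0_norm.
  by rewrite /= dotvDr dotvZr cv ceu addr0.
move=> /= /eqP; rewrite -subr_eq0 addrAC subrr add0r scaler_eq0 gt_eqF//.
by move=> /eqP.
Qed.

Definition active v : {set 'I_k} := [set j | dotv (N j) v == b j].

Lemma card_active_ge v : vertices Q v -> (n <= #|active v|)%N.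
Proof.
move=> vv; pose A : 'M[R]_(#|active v|, n) := \matrix_i N (enum_val i).
suff /eqP <- : row_free A^T by exact: rank_leq_col.
rewrite -kermx_eq0; apply/eqP/row_matrixP => i; rewrite row0.
apply: (vertex_normals_span vv) => j vj.
have jA : j \in active v by rewrite inE vj.
have : row i (kermx A^T) *m A^T = 0 by rewrite -row_mul mulmx_ker row0.
move=> /matrixP/(_ 0 (enum_rank_in jA j)); rewrite mxE [RHS]mxE => <-.
rewrite /dotv; apply: eq_bigr => l _.
by rewrite mulrC; congr (_ * _); rewrite !mxE enum_rankK_in.
Qed.

Let constraint_facet j := Q `&` [set x | dotv (N j) x = b j].

Lemma constraint_facet_inj : injective constraint_facet.
Proof.
move=> i j eqF; apply/eqP/negPn/negP => ij.
have [x xi xl] := facet_point i.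
have : constraint_facet i x.
  split=> // l; have [->|/xl/ltW//] := eqVneq l i; by rewrite xi.
rewrite eqF => -[_ /= xj]; have := xl j.
by rewrite eq_sym ij xj ltxx => /(_ isT).
Qed.

(** The constraints tight at [v] inject into the [n] facets through [v], and
    there are at least [n] of them by [card_active_ge]; so they are exactly
    the facets through [v]. *)
Lemma simple_vertex_facets v : vertices Q v ->
  ([set F | facet Q F /\ F v] #= `I_n)%card ->
  #|active v| = n /\
  forall G, facet Q G -> G v ->
    exists2 j, j \in active v & G = constraint_facet j.
Proof.
move=> vv /card_bijP[f fbij].
have Qv := vertex_in vv.
have fP j : j \in active v ->
    [set F | facet Q F /\ F v] (constraint_facet j).
  by rewrite inE => /eqP vj; split; [exact: facet_constraint | split].
pose fac G (GP : [set F | facet Q F /\ F v] G) : [set F | facet Q F /\ F v] :=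
  SigSub (mem_set GP).
pose f' G GP : 'I_n := Ordinal (set_mem (valP (f (@fac G GP)))).
have f'_inj G GP G' GP' : @f' G GP = @f' G' GP' -> G = G'.
  by move=> /(congr1 val)/= /val_inj /(bij_inj fbij) /(congr1 val).
pose h (i : 'I_#|active v|) : 'I_n := f' _ (fP _ (enum_valP i)).
have hinj : injective h.
  by move=> i i' /f'_inj /constraint_facet_inj/enum_val_inj.
have cardA : #|active v| = n.
  apply/eqP; rewrite eqn_leq card_active_ge// andbT.
  by have := leq_card _ hinj; rewrite !card_ord.
split=> // G fG Gv.
have GP : [set F | facet Q F /\ F v] G by [].
have /codomP[i hi] : f' G GP \in codom h.
  by apply: inj_card_onto hinj _ _; rewrite !card_ord cardA.
by exists (enum_val i); [exact: enum_valP | exact: f'_inj hi].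
Qed.

End FixedPresentation.
End Presentations.

(** * Affine charts at a vertex *)

Lemma aff_dim_uniq {R : realType} {n : nat} (A : set 'rV[R]_n) k l :
  aff_dim A k -> aff_dim A l -> k = l.
Proof.
wlog suff H : k l / aff_dim A k -> aff_dim A l -> (k <= l)%N.
  by move=> Ak Al; apply/eqP; rewrite eqn_leq !H.
move=> [x0 [M [Ax0 Mfree AM _]]] [y0 [M' [_ _ _ AM']]].
have /eqP <- := Mfree; apply: leq_trans (mxrankS _) (rank_leq_row M').
apply/row_subP => i.
have -> : row i M = (x0 + row i M - y0) - (x0 - y0).
  by rewrite opprB addrA subrK addrAC subrr add0r.
by rewrite addmx_sub ?eqmx_opp ?AM'.
Qed.

Section VertexCharts.
Context {R : realType} {n : nat}.
Implicit Types (Q P F G H : set 'rV[R]_n) (x v : 'rV[R]_n).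

Definition corner k (L : 'I_k -> 'rV[R]_n) : set 'rV[R]_n :=
  [set y : 'rV[R]_n | (forall i, 0 <= y 0 i) /\ forall j, dotv (L j) y <= 1].

(** In the affine coordinates [(x - v) *m D] the polytope is a neighbourhood
    of 0 in the orthant, cut by finitely many further constraints, normalized
    so that they read [L j . y <= 1]; the facets through [v] are the
    coordinate walls. *)
Record vertex_chart Q v (D : 'M[R]_n) k (L : 'I_k -> 'rV[R]_n) : Prop := {
  chart_unit : D \in unitmx;
  chart_polytope : forall x, Q x <-> corner L ((x - v) *m D);
  chart_facets : forall G, facet Q G /\ G v <->
    exists i, G = Q `&` [set x | ((x - v) *m D) 0 i = 0] }.

(** The coordinates are the slacks of the [n] constraints tight at [v], whose
    normals form a basis. *)
Lemma exists_vertex_chart Q v : simple_polytope Q -> vertices Q v ->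
  exists (D : 'M[R]_n) k (L : 'I_k -> 'rV[R]_n), vertex_chart Q v D L.
Proof.
move=> [poly full simple] vv.
have [k [N [b [QE irr]]]] := irredundant_presentation poly.
rewrite QE in vv full simple *.
have [cardA facA] := simple_vertex_facets irr full vv (simple v vv).
have Qv := vertex_in vv.
pose a (i : 'I_n) : 'I_k := enum_val (cast_ord (esym cardA) i).
have aact i : dotv (N (a i)) v = b (a i).
  by have := enum_valP (cast_ord (esym cardA) i); rewrite inE => /eqP.
have asurj j : dotv (N j) v = b j -> exists i, j = a i.
  move=> vj; have jA : j \in active N b v by rewrite inE vj.
  exists (cast_ord cardA (enum_rank_in jA j)).
  by rewrite /a cast_ordK enum_rankK_in.
pose D := \matrix_(h, i) - N (a i) 0 h.
have DE x i : ((x - v) *m D) 0 i = b (a i) - dotv (N (a i)) x.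
  rewrite -aact -dotvBr -[v - x]opprB dotvNr dotvC mxE -sumrN.
  by apply: eq_bigr => h _; rewrite !mxE; ring.
have Du : D \in unitmx.
  rewrite -row_free_unit -kermx_eq0; apply/eqP/row_matrixP => i; rewrite row0.
  apply: (vertex_normals_span vv) => j /asurj[l ->].
  have := DE (v + row i (kermx D)) l.
  rewrite addrAC subrr add0r -row_mul mulmx_ker row0 mxE dotvDr aact.
  by move=> ?; lra.
pose s j := b j - dotv (N j) v.
(* the constraints tight at v are the nonnegativity of the coordinates *)
pose L j := if dotv (N j) v == b j then 0
            else (s j)^-1 *: (N j *m (invmx D)^T).
have LE j x : dotv (N j) v != b j ->
    dotv (L j) ((x - v) *m D) = (s j)^-1 * dotv (N j) (x - v).
  by move=> vj; rewrite /L (negbTE vj) dotvZl -dotv_mulmx mulmxK.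
exists D, k, L; split=> // [x|G].
  split=> [Qx|[y0 Ly] j].
    split=> [i|j]; first by rewrite DE subr_ge0.
    have [vj|vj] := boolP (dotv (N j) v == b j).
      by rewrite /L vj dotv0l.
    have s0 : 0 < s j by rewrite subr_gt0 lt_neqAle vj; exact: Qv.
    by rewrite LE// ler_pdivrMl// mulr1 dotvBr lerD2r; exact: Qx.
  have [vj|vj] := eqVneq (dotv (N j) v) (b j).
    by have [i ->] := asurj j vj; rewrite -subr_ge0 -DE.
  have s0 : 0 < s j by rewrite subr_gt0 lt_neqAle vj; exact: Qv.
  have := Ly j.
  by rewrite LE// ler_pdivrMl// mulr1 dotvBr lerD2r.
have wallE i : halfspaces N b `&` [set x | ((x - v) *m D) 0 i = 0] =
    halfspaces N b `&` [set x | dotv (N (a i)) x = b (a i)].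
  apply/seteqP; split=> x [Qx] /=; rewrite DE => e; split=> //=;
    last by rewrite e subrr.
  by apply/esym/eqP; rewrite -subr_eq0 e.
split=> [[fG Gv]|[i ->]].
  have [j] := facA G fG Gv; rewrite inE => /eqP /asurj[i ->] ->.
  by exists i; rewrite wallE.
rewrite wallE; split; first exact: facet_constraint.
by split=> //=; rewrite aact.
Qed.

Section Chart.
Variables (Q : set 'rV[R]_n) (v : 'rV[R]_n).
Variables (D : 'M[R]_n) (k : nat) (L : 'I_k -> 'rV[R]_n).
Hypothesis chartQ : vertex_chart Q v D L.
Implicit Types (I J : {set 'I_n}) (y : 'rV[R]_n).

Definition coord (v : 'rV[R]_n) (D : 'M[R]_n) x := (x - v) *m D.
Definition point (v : 'rV[R]_n) (D : 'M[R]_n) y := v + y *m invmx D.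
Local Notation cd := (coord v D).
Local Notation pt := (point v D).

Lemma coordK : cancel cd pt.
Proof.
move=> x; rewrite /point /coord mulmxK ?(chart_unit chartQ)//.
by rewrite addrC subrK.
Qed.

Lemma pointK : cancel pt cd.
Proof.
move=> y; rewrite /point /coord addrAC subrr add0r.
by rewrite mulmxKV ?(chart_unit chartQ).
Qed.

Lemma coord_vertex : cd v = 0.
Proof. by rewrite /coord subrr mul0mx. Qed.

Lemma corner_coord x : Q x <-> corner L (cd x).
Proof. exact: (chart_polytope chartQ). Qed.

Lemma corner_point y : corner L y <-> Q (pt y).
Proof. by rewrite corner_coord pointK. Qed.

Lemma coord_ge0 x i : Q x -> 0 <= cd x 0 i.
Proof. by move=> /corner_coord[]. Qed.

Definition coord_face (Q : set 'rV[R]_n) v D I : set 'rV[R]_n :=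
  Q `&` [set x | forall i, i \notin I -> coord v D x 0 i = 0].
Definition coord_wall (Q : set 'rV[R]_n) v D i : set 'rV[R]_n :=
  Q `&` [set x | coord v D x 0 i = 0].
Local Notation cface := (coord_face Q v D).
Local Notation cwall := (coord_wall Q v D).

Lemma coord_face_vertex I : cface I v.
Proof.
split=> [|i _]; last by rewrite coord_vertex mxE.
apply/corner_coord; rewrite coord_vertex.
by split=> [i|j]; rewrite ?mxE// dotv0r.
Qed.

Lemma coord_faceT : cface [set: 'I_n]%SET = Q.
Proof.
by apply/seteqP; split=> [x []//|x Qx]; split=> // i; rewrite inE.
Qed.

Lemma facet_vertexP G : facet Q G /\ G v <-> exists i, G = cwall i.
Proof. exact: (chart_facets chartQ). Qed.

Lemma dotv_coord c x : dotv c (x - v) = dotv (c *m (invmx D)^T) (cd x).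
Proof. by rewrite -dotv_mulmx /coord mulmxK ?(chart_unit chartQ). Qed.

Lemma edge_vectors :
  exists2 e, 0 < e & forall i, Q (pt (e *: delta_mx 0 i)).
Proof.
have [//|e e0 He] := small_scale (T := ('I_k * 'I_n)%type)
  (fun p => dotv (L p.1) (delta_mx 0 p.2)) (d := fun=> 1).
exists e => // i; apply/corner_point; split=> [l|j].
  by rewrite !mxE mulr_ge0 ?ler0n// ltW.
rewrite dotvZr (le_trans _ (ltW (He (j, i))))//.
by rewrite ler_wpM2l ?ler_norm// ltW.
Qed.

Lemma coord_face_edge e I i : Q (pt (e *: delta_mx 0 i)) -> i \in I ->
  cface I (pt (e *: delta_mx 0 i)).
Proof.
move=> Qe iI; split=> // l lI; rewrite pointK !mxE/=.
by case: eqP => [li|_]; [rewrite li iI in lI | rewrite mulr0].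
Qed.

Lemma coord_face_sub_wall I i : cface I `<=` cwall i <-> i \notin I.
Proof.
split=> [Iw|iI x [Qx xI]]; last by split=> //; exact: xI.
apply/negP => iI; have [e e0 Qe] := edge_vectors.
have [_ /=] := Iw _ (coord_face_edge (Qe i) iI).
by rewrite pointK !mxE !eqxx mulr1 => /eqP; rewrite gt_eqF.
Qed.

Lemma wall_inj : injective cwall.
Proof.
move=> i j wij; apply/eqP/negPn/negP => ij.
have [_] := coord_face_sub_wall [set j]%SET i.
rewrite inE => /(_ ij); rewrite wij => /coord_face_sub_wall.
by rewrite inE eqxx.
Qed.

(** Up to its value at [v], a functional supporting a face through [v] is a
    combination of the coordinates, with nonpositive coefficients at the
    indices in [I]; the face is where the coordinates with a nonzero
    coefficient vanish. *)
Lemma face_coord_face I H : face (cface I) H -> H v ->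
  exists2 J : {set 'I_n}, J \subset I & H = cface J.
Proof.
move=> [_ [c [b [cb HE]]]] Hv.
have [_ /= cv] : (cface I `&` [set x | dotv c x = b]) v by rewrite -HE.
pose g := c *m (invmx D)^T.
have cE x : dotv c x = b + dotv g (cd x).
  by rewrite -dotv_coord dotvBr cv addrCA subrr addr0.
clearbody g.
have [e e0 Qe] := edge_vectors.
have g_delta i : dotv g (e *: delta_mx 0 i) = e * g 0 i.
  rewrite dotvZr /dotv (bigD1 i)//= big1 ?addr0 => [|l li].
    by rewrite mxE !eqxx mulr1.
  by rewrite mxE (negbTE li) andbF mulr0.
have gle0 i : i \in I -> g 0 i <= 0.
  move=> iI; have := cb _ (coord_face_edge (Qe i) iI).
  by rewrite cE pointK gerDl g_delta pmulr_rle0.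
exists [set i in I | g 0 i == 0]%SET.
  by apply/fintype.subsetP => i; rewrite inE => /andP[].
have termle x i : cface I x -> g 0 i * cd x 0 i <= 0.
  move=> [Qx xI]; have [iI|iI] := boolP (i \in I); last by rewrite xI// mulr0.
  by rewrite mulr_le0_ge0 ?gle0 ?coord_ge0.
rewrite HE; apply/seteqP; split=> x.
  move=> [[Qx xI]] /=; rewrite cE => cgx.
  have gx : dotv g (cd x) = 0 by lra.
  split=> // i; rewrite inE negb_and => /orP[/xI//|gi].
  have [iI|/xI//] := boolP (i \in I).
  have gx0 : \sum_l - (g 0 l * cd x 0 l) = 0.
    by rewrite sumrN -/(dotv g (cd x)) gx oppr0.
  have /eqP : - (g 0 i * cd x 0 i) = 0.
    by apply: (psumr_eq0P _ gx0) => // l _; rewrite oppr_ge0 termle.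
  by rewrite oppr_eq0 mulf_eq0 (negbTE gi) => /eqP.
move=> [Qx xJ]; have Ix : cface I x.
  by split=> // i iI; apply: xJ; rewrite inE negb_and iI.
split=> //=; rewrite cE /dotv big1 ?addr0// => i _.
have [iJ|/xJ->] := boolP (i \in [set i in I | g 0 i == 0]%SET);
  last by rewrite mulr0.
by move: iJ; rewrite inE => /andP[_ /eqP->]; rewrite mul0r.
Qed.

Lemma aff_dim_coord_face I : aff_dim (cface I) #|I|.
Proof.
have [e e0 Qe] := edge_vectors.
pose B : 'M[R]_(#|I|, n) := \matrix_(r, i) (i == enum_val r)%:R.
have Brow r : row r B = delta_mx 0 (enum_val r).
  by apply/rowP => i; rewrite !mxE.
have Bfree : row_free B.
  apply/row_freeP; exists B^T; apply/matrixP => r s; rewrite !mxE.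
  rewrite (bigD1 (enum_val r))//= big1 ?addr0 => [|i ir].
    by rewrite !mxE eqxx mul1r (inj_eq enum_val_inj).
  by rewrite !mxE (negbTE ir) mul0r.
have Du : row_free (invmx D).
  by rewrite row_free_unit unitmx_inv (chart_unit chartQ).
exists v, (e *: B *m invmx D); split=> //.
- exact: coord_face_vertex.
- rewrite /row_free mxrankMfree// (mxrank_scale_nz _ (lt0r_neq0 e0)).
  exact: Bfree.
- move=> r; rewrite row_mul linearZ/= Brow -/(pt _).
  exact: (coord_face_edge (Qe _) (enum_valP r)).
- move=> x [Qx xI].
  have -> : x - v = cd x *m invmx D by rewrite mulmxK ?(chart_unit chartQ).
  apply: submxMr; rewrite (eqmx_scale _ (lt0r_neq0 e0)).
  have {xI} : forall i, i \notin I -> cd x 0 i = 0 by [].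
  move: (cd x) => y yI.
  have -> : y = (\row_r y 0 (enum_val r)) *m B.
    apply/rowP => i; rewrite [RHS]mxE.
    have [iI|iI] := boolP (i \in I).
      rewrite (bigD1 (enum_rank_in iI i))//= big1 ?addr0 => [|r ri].
        by rewrite !mxE enum_rankK_in// eqxx mulr1.
      rewrite !mxE; case: eqP => [ir|_]; last by rewrite mulr0.
      case/eqP: ri; apply: enum_val_inj; by rewrite enum_rankK_in.
    rewrite yI// big1// => r _; rewrite !mxE.
    case: eqP => [ir|_]; last by rewrite mulr0.
    by move: iI; rewrite ir enum_valP.
  exact: submxMl.
Qed.

Lemma facet_coord_face I H : facet (cface I) H -> H v ->
  exists2 i, i \in I & H = cface I `&` cwall i.
Proof.
move=> [fH [d dI dH]] Hv; have [J JI HE] := face_coord_face fH Hv.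
have cI := aff_dim_uniq dI (aff_dim_coord_face I).
have cJ : d = #|J|.
  by apply: aff_dim_uniq dH _; rewrite HE; exact: aff_dim_coord_face.
have /cards1P[i IJ] : #|I :\: J| == 1%N.
  by rewrite cardsDS// -cI -cJ subSn// subnn.
have /setDP[iI iJ] : i \in (I :\: J)%SET by rewrite IJ inE.
exists i => //; rewrite HE; apply/seteqP; split=> x.
  move=> [Qx xJ]; split; last by split=> //; exact: xJ.
  by split=> // l lI; apply: xJ; apply: contra lI; exact: (fintype.subsetP JI).
move=> [[Qx xI] [_ xi]]; split=> // l lJ.
have [lI|/xI//] := boolP (l \in I).
have : l \in (I :\: J)%SET by apply/setDP.
by rewrite IJ inE => /eqP->.
Qed.

(** A face containing [x] but not [v] would have a supporting functional that
    grows from [v] to [x], hence beyond [x]; but the polytope extends a little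
    beyond [x] in that direction. *)
Lemma inner_face_vertex x F : Q x -> (forall j, dotv (L j) (cd x) < 1) ->
  face Q F -> F x -> F v.
Proof.
move=> Qx Lx [_ [c [b [cb FE]]]] Fx.
have [_ /= cx] : (Q `&` [set x | dotv c x = b]) x by rewrite -FE.
have Qv : Q v by have [] := coord_face_vertex finset.set0.
rewrite FE; split=> //=; apply/eqP; rewrite eq_le cb//=.
have [j|e e0 He] := small_scale (fun j => dotv (L j) (cd x))
  (d := fun j => 1 - dotv (L j) (cd x)).
  by rewrite subr_gt0.
have /cb : Q (x + e *: (x - v)).
  apply/corner_coord.
  have -> : cd (x + e *: (x - v)) = (1 + e) *: cd x.
    by rewrite /coord scalerDl scale1r addrAC mulmxDl scalemxAl.
  split=> [i|j]; first by rewrite mxE mulr_ge0 ?coord_ge0// addr_ge0// ltW.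
  rewrite dotvZr mulrDl mul1r -lerBrDl (le_trans _ (ltW (He j)))//.
  by rewrite ler_wpM2l ?ler_norm// ltW.
rewrite dotvDr dotvZr dotvBr cx gerDl pmulr_rle0// subr_le0.
by [].
Qed.

(** The neighbourhood of [v] in [P] that occurs in retraction sequences; the
    faces of [P] are written as the faces of [Q] inside [P]. *)
Definition open_star (Q P : set 'rV[R]_n) v : set 'rV[R]_n :=
  P `\` \bigcup_(F in [set F | face Q F /\ F `<=` P /\ ~ F v]) F.

(** A point where [L j . y = 1] lies on the face cut out of [coord_face I] by
    that constraint, whose supporting functional is a sum of two; the converse
    is [inner_face_vertex]. *)
Lemma open_starE I x : face Q (cface I) ->
  open_star Q (cface I) v x <->
  cface I x /\ forall j, dotv (L j) (cd x) < 1.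
Proof.
move=> fI; split=> [[Ix nF]|[Ix Lx]]; last first.
  split=> // -[F [fF [FP nFv]] Fx]; apply: nFv.
  by apply: (inner_face_vertex _ Lx) fF Fx; case: Ix.
split=> // j; have [Qx _] := Ix; have [_ Lx] := (corner_coord x).1 Qx.
rewrite lt_neqAle Lx andbT; apply/eqP => xj; apply: nF.
exists (cface I `&` [set x | dotv (L j) (cd x) = 1]); last by split.
split; last first.
  split; first by move=> ? [].
  move=> [_ /=]; rewrite coord_vertex dotv0r => /eqP.
  by rewrite eq_sym oner_eq0.
have [_ [c [b [cb IE]]]] := fI.
split; first by exists x; split.
pose g := L j *m D^T.
have gE z : dotv (L j) (cd z) = dotv g z - dotv g v.
  by rewrite /coord dotv_mulmx dotvBr.
exists (c + g), (b + (1 + dotv g v)); split=> [z Qz|].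
  rewrite dotvDl lerD ?cb// -lerBlDr -gE; by have [_] := (corner_coord z).1 Qz.
apply/seteqP; split=> z.
  move=> [Iz /=]; rewrite gE => gz.
  have : (Q `&` [set x | dotv c x = b]) z by rewrite -IE.
  by move=> [Qz /= cz]; split=> //=; rewrite dotvDl cz -gz subrK.
move=> [Qz /=]; rewrite dotvDl => cgz.
have cz := cb z Qz.
have [_ /(_ j) gz] := (corner_coord z).1 Qz; rewrite gE in gz.
have Iz : cface I z by rewrite IE; split=> //=; lra.
have Lz : dotv (L j) (cd z) = 1 by rewrite gE; lra.
by split.
Qed.

End Chart.
End VertexCharts.

(** * The local group and integral coordinates on the torus *)

Section QuotientGroups.
Context {V : zmodType}.
Implicit Types (A : set V) (x y : V).

Lemma gen_subgroup_is_subgroup A : is_subgroup (gen_subgroup A).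
Proof.
split=> [H [sH _]|x y Hx Hy H [sH AH]]; first exact: sH.1.
by apply: sH.2; [exact: Hx | exact: Hy].
Qed.

Lemma sub_gen_subgroup A : A `<=` gen_subgroup A.
Proof. by move=> x Ax H [_]; apply. Qed.

Lemma gen_subgroup_min A H : is_subgroup H -> A `<=` H -> gen_subgroup A `<=` H.
Proof. by move=> sH AH x; apply. Qed.

Lemma quotient_proj_eq A x y :
  quotient_proj A x = quotient_proj A y <-> gen_subgroup A (x - y).
Proof.
rewrite /quotient_proj; split.
  by move=> /eqP; rewrite -Quotient.idealrBE => /asboolP.
by move=> Axy; apply/eqP; rewrite -Quotient.idealrBE; exact/asboolP.
Qed.

Lemma quotient_proj_surj A (q : quotient_group A) :
  exists x, quotient_proj A x = q.
Proof. by exists (repr q); rewrite /quotient_proj reprK. Qed.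

Lemma quotient_projB A x y :
  quotient_proj A (x - y) = quotient_proj A x - quotient_proj A y.
Proof. by rewrite /quotient_proj !piE. Qed.

Lemma quotient_proj0 A : quotient_proj A 0 = 0.
Proof. by rewrite /quotient_proj !piE. Qed.

Lemma quotient_projMn A x k : quotient_proj A (x *+ k) = quotient_proj A x *+ k.
Proof.
elim: k => [|k IH]; first by rewrite !mulr0n quotient_proj0.
by rewrite !mulrS -IH /quotient_proj [RHS]piE.
Qed.

Lemma trivial_quotient_gen A :
  (forall g : quotient_group A, g = 0) -> forall x, gen_subgroup A x.
Proof.
move=> triv x; rewrite -[x]subr0.
apply/quotient_proj_eq.
by rewrite (triv (quotient_proj A x)) (triv (quotient_proj A 0)).
Qed.

End QuotientGroups.

Section AngularCoordinates.
Context {R : realType} {n : nat}.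
Variables (Q : set 'rV[R]_n) (lambda : set 'rV[R]_n -> 'rV[int]_n).
Variables (v : 'rV[R]_n) (D : 'M[R]_n) (k : nat) (L : 'I_k -> 'rV[R]_n).
Hypotheses (chartQ : vertex_chart Q v D L).
Hypothesis charQ : characteristic_function Q lambda.
Implicit Types (I K : {set 'I_n}) (u : 'rV[R]_n) (z : 'rV[int]_n).
Local Notation cface := (coord_face Q v D).
Local Notation cwall := (coord_wall Q v D).

Definition char_matrix (Q : set 'rV[R]_n) v D : 'M[R]_n :=
  \matrix_(i, j) (lambda (coord_wall Q v D i) 0 j)%:~R.

Definition char_coord (Q : set 'rV[R]_n) v D u i : R :=
  (u *m invmx (char_matrix Q v D)) 0 i.
Local Notation cmx := (char_matrix Q v D).
Local Notation cc := (char_coord Q v D).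
Local Notation intvR := (@intv R n).

(** A determinant zero would give an integral relation between the
    characteristic vectors of the [n] facets through [v]. *)
Lemma char_matrix_unit : cmx \in unitmx.
Proof.
pose Z := \matrix_(i, j) lambda (cwall i) 0 j.
have -> : cmx = map_mx intr Z by apply/matrixP => i j; rewrite !mxE.
rewrite unitmxE det_map_mx unitfE intr_eq0; apply/det0P => -[c c0 cZ].
have facw i : facet Q (cwall i) /\ cwall i v.
  by apply/(facet_vertexP chartQ); exists i.
have [||//|H _] := @charQ n (fun i => cwall i).
- exact: wall_inj chartQ.
- by move=> i; have [] := facw i.
- by exists v => i _; have [] := facw i.
case/eqP: c0; apply/rowP => i; rewrite mxE; apply: H.
apply/rowP => j; have /matrixP/(_ 0 j) := cZ; rewrite [RHS]mxE mxE mxE => <-.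
rewrite summxE.
by apply: eq_bigr => l _; rewrite !mxE.
Qed.

Lemma row_char_matrix i : row i cmx = intvR (lambda (cwall i)).
Proof. by apply/rowP => j; rewrite !mxE. Qed.

Lemma char_coordB u w i : cc (u - w) i = cc u i - cc w i.
Proof. by rewrite /char_coord mulmxBl !mxE. Qed.

Lemma char_coordD u w i : cc (u + w) i = cc u i + cc w i.
Proof. by rewrite /char_coord mulmxDl mxE. Qed.

Lemma char_coordZ a u i : cc (a *: u) i = a * cc u i.
Proof. by rewrite /char_coord -scalemxAl mxE. Qed.

Lemma char_coord0 i : cc 0 i = 0.
Proof. by rewrite /char_coord mul0mx mxE. Qed.

Lemma char_coord_sum (T : Type) (r : seq T) (F : T -> 'rV[R]_n) i :
  cc (\sum_(t <- r) F t) i = \sum_(t <- r) cc (F t) i.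
Proof. by rewrite /char_coord mulmx_suml summxE. Qed.

Lemma char_coord_lambda i j : cc (intvR (lambda (cwall i))) j = (i == j)%:R.
Proof.
rewrite -row_char_matrix /char_coord -row_mul mulmxV ?char_matrix_unit//.
by rewrite !mxE.
Qed.

Lemma char_coord_expand u : u = \sum_i cc u i *: intvR (lambda (cwall i)).
Proof.
rewrite -[LHS](mulmxKV char_matrix_unit) {1}mulmx_sum_row.
by apply: eq_bigr => i _; rewrite row_char_matrix.
Qed.

Lemma intvB z w : intvR (z - w) = intvR z - intvR w.
Proof. by rewrite /intv map_mxB. Qed.

Lemma intv0 : intvR 0 = 0.
Proof. by rewrite /intv map_mx0. Qed.

Lemma intvMn z m : intvR (z *+ m) = m%:R *: intvR z.
Proof. by apply/rowP => j; rewrite !mxE mulmxnE rmorphMn mulr_natl. Qed.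

(** The characteristic vectors of the walls form a basis, so the span of some
    of them is a coordinate subspace. *)
Lemma M_realP F K u :
  (forall G, (facet Q G /\ F `<=` G) <-> exists2 i, i \in K & G = cwall i) ->
  M_real Q lambda F u <-> forall i, i \notin K -> cc u i = 0.
Proof.
move=> FK; split.
  move=> [m [c [z [Mz ->]]]] i iK; rewrite char_coord_sum big1// => l _.
  rewrite char_coordZ.
  suff -> : cc (intvR (z l)) i = 0 by rewrite mulr0.
  have := Mz l; apply: (gen_subgroup_min (H := [set z | cc (intvR z) i = 0])).
    split=> [|x y /= xi yi]; first by rewrite /= intv0 char_coord0.
    by rewrite intvB char_coordB xi yi subr0.
  move=> _ [G [fG FG] <-]; have [j jK ->] := (FK G).1 (conj fG FG).
  rewrite /= char_coord_lambda; case: eqP => // ji.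
  by rewrite -ji jK in iK.
move=> uK; exists n, (cc u), (fun i => if i \in K then lambda (cwall i) else 0).
split=> [i|].
  case: ifPn => iK; last exact: (gen_subgroup_is_subgroup _).1.
  apply: sub_gen_subgroup; exists (cwall i) => //.
  by apply/FK; exists i.
rewrite {1}[u]char_coord_expand; apply: eq_bigr => i _.
by case: ifPn => // iK; rewrite uK// !scale0r.
Qed.

Lemma M_real_coord_face I u :
  M_real Q lambda (cface I) u <-> forall i, i \in I -> cc u i = 0.
Proof.
rewrite (@M_realP _ (~: I)%SET) => [|G].
  by split=> H i iI; apply: H; move: iI; rewrite inE ?negbK.
split=> [[fG IG]|[i iI ->]].
  have Gv : G v by apply: IG; exact: (coord_face_vertex chartQ).
  have [i Gi] := (facet_vertexP chartQ G).1 (conj fG Gv).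
  exists i => //; rewrite inE; apply/(coord_face_sub_wall chartQ).
  by rewrite -Gi.
have [fw _] : facet Q (cwall i) /\ cwall i v.
  by apply/(facet_vertexP chartQ); exists i.
by split=> //; apply/(coord_face_sub_wall chartQ); rewrite inE in iI.
Qed.

Lemma M_real_min_face x u : Q x -> (forall j, dotv (L j) (coord v D x) < 1) ->
  M_real Q lambda (min_face Q x) u <->
  forall i, coord v D x 0 i != 0 -> cc u i = 0.
Proof.
move=> Qx Lx.
rewrite (@M_realP _ [set i | coord v D x 0 i == 0]%SET) => [|G].
  by split=> H i xi; apply: H; move: xi; rewrite inE.
split=> [[fG IG]|[i xi ->]].
  have Gx : G x by apply: IG => F [_]; exact.
  have Gv : G v by apply: (inner_face_vertex chartQ Qx Lx) Gx; case: fG.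
  have [i Gi] := (facet_vertexP chartQ G).1 (conj fG Gv).
  exists i => //; rewrite inE; apply/eqP.
  by move: Gx; rewrite Gi => -[].
have [fw _] : facet Q (cwall i) /\ cwall i v.
  by apply/(facet_vertexP chartQ); exists i.
split=> // y; apply; split; first by case: fw.
by move=> _ ->; split=> //; move: xi; rewrite inE => /eqP.
Qed.

Lemma M_star_subgroup F : is_subgroup (M_star Q lambda F).
Proof.
have [M0 MB] := @real_span_subgroup R n (M_of Q lambda F).
by split=> [|x y Mx My]; rewrite /M_star /= ?intv0// intvB; exact: MB.
Qed.

Lemma gen_M_star F : gen_subgroup (M_star Q lambda F) = M_star Q lambda F.
Proof.
apply/seteqP; split; last exact: sub_gen_subgroup.
by apply: gen_subgroup_min => //; exact: M_star_subgroup.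
Qed.

Section TrivialLocalGroup.
Variable I : {set 'I_n}.
Hypothesis trivI : forall g : local_group Q lambda (cface I) v, g = 0.
Local Notation rhoI := (rho Q lambda (cface I)).
Local Notation lam i := (lambda (cwall i)).

Lemma rho_eq z w : rhoI z = rhoI w <->
  forall i, i \in I -> cc (intvR z) i = cc (intvR w) i.
Proof.
rewrite /rho quotient_proj_eq gen_M_star /M_star /= M_real_coord_face intvB.
split=> H i iI; first by apply/eqP; rewrite -subr_eq0 -char_coordB H.
by rewrite char_coordB H// subrr.
Qed.

(** [facet_cutting] is a choice, but whatever facet it chooses contains [v],
    hence is a coordinate wall. *)
Lemma facet_cutting_wall H : facet (cface I) H -> H v ->
  exists2 i, i \in I & facet_cutting Q (cface I) H = cwall i.
Proof.
move=> fH Hv; have [i iI HE] := facet_coord_face chartQ fH Hv.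
rewrite /facet_cutting; set S := [set G | _].
have [fG HG] : S (xget set0 S).
  apply: (xgetPex set0 (P := S)); exists (cwall i); split=> //.
  by have [] := (facet_vertexP chartQ (cwall i)).2 (ex_intro _ i erefl).
have Gv : xget set0 S v by move: Hv; rewrite {1}HG => -[].
have [j Gj] := (facet_vertexP chartQ _).1 (conj fG Gv).
exists j => //; apply/negPn/negP => jI.
have : cface I `<=` cwall i.
  have : cface I `<=` cwall j by apply/(coord_face_sub_wall chartQ).
  move=> Ij x Ix; suff : H x by rewrite HE => -[].
  by rewrite HG Gj; split=> //; exact: Ij.
by move=> /(coord_face_sub_wall chartQ); rewrite iI.
Qed.

(** Triviality of the local group, as an induction principle on the lattice of
    the face. *)
Lemma lambda_face_generate (S : set (face_lattice Q lambda (cface I))) :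
  is_subgroup S -> (forall i, i \in I -> S (prim (rhoI (lam i)))) ->
  forall z, S (rhoI z).
Proof.
move=> sS Sprim z; have := trivial_quotient_gen trivI (rhoI z).
apply: gen_subgroup_min => // _ [H [fH Hv] <-].
have [i iI e] := facet_cutting_wall fH Hv.
by rewrite /lambda_face e; exact: Sprim.
Qed.

Lemma rho_multiple z m i j : i \in I -> j \in I ->
  rhoI (lam i) = rhoI z *+ m -> m%:R * cc (intvR z) j = (i == j)%:R.
Proof.
move=> iI jI; rewrite /rho -quotient_projMn => /rho_eq /(_ j jI).
by rewrite char_coord_lambda intvMn char_coordZ.
Qed.

(** If [rhoI (lam i)] were no multiple of a primitive vector, its [prim] would
    be 0, and the lattice would be generated by vectors whose [i]-th
    coordinate is 0; but that of [lam i] is 1. *)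
Lemma prim_lambda i : i \in I -> exists m z, [/\ (0 < m)%N,
  rhoI z = prim (rhoI (lam i)) & rhoI (lam i) = rhoI z *+ m].
Proof.
have prim_or j : prim (rhoI (lam j)) = 0 \/ exists m z, [/\ (0 < m)%N,
    rhoI z = prim (rhoI (lam j)) & rhoI (lam j) = rhoI z *+ m].
  rewrite /prim; set S := [set y | _].
  have [[y Sy]|nS] := pselect (exists y, S y); last first.
    by left; apply: xgetPN => y Sy; apply: nS; exists y.
  right; have [_ [m m0 e]] : S (xget 0 S) by apply: (xgetPex 0); exists y.
  have [z zE] := quotient_proj_surj (xget 0 S).
  by exists m, z; split=> //; rewrite /rho zE.
move=> iI; have [pi0|//] := prim_or i; exfalso.
pose S := [set q | forall z, rhoI z = q -> cc (intvR z) i = 0].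
have S0 : S 0.
  move=> z; rewrite -(quotient_proj0 (M_star _ _ _)) -/(rhoI _).
  by move=> /rho_eq ->//; rewrite intv0 char_coord0.
have : S (rhoI (lam i)).
  apply: (@lambda_face_generate S) => [|j jI].
    split=> // x y Sx Sy z zE.
    have [zx xE] := quotient_proj_surj x; have [zy yE] := quotient_proj_surj y.
    have /rho_eq -> // : rhoI z = rhoI (zx - zy).
      by rewrite zE -xE -yE -quotient_projB.
    by rewrite intvB char_coordB Sx// Sy// subrr.
  have [->//|[m [z [m0 zE lamE]]]] := prim_or j.
  have [ji|ji] := eqVneq j i; first by rewrite ji pi0.
  move=> w; rewrite -zE => /rho_eq -> //; have := rho_multiple jI iI lamE.
  by rewrite (negbTE ji) => /eqP; rewrite mulf_eq0 pnatr_eq0 gtn_eqF// => /eqP.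
move=> /(_ _ erefl); rewrite char_coord_lambda eqxx => /eqP.
by rewrite oner_eq0.
Qed.

(** The primitive vectors $\lambda_F(H_i)$ generate the lattice of the face,
    so they form a basis of it; multiplying the [i]-th characteristic
    coordinate by the integer [m i] such that, in that lattice, [lam i] is [m
    i] times the [i]-th primitive vector, gives the coordinate in that basis,
    which is integral on integral vectors. *)
Lemma angular_coordinates : exists m : 'I_n -> nat,
  [/\ forall i, (0 < m i)%N,
      forall z i, i \in I -> exists a : int, (m i)%:R * cc (intvR z) i = a%:~R
    & forall i, i \in I -> exists z,
        forall j, j \in I -> (m j)%:R * cc (intvR z) j = (i == j)%:R].
Proof.
pose good i (p : nat * 'rV[int]_n) := i \in I ->
    [/\ (0 < p.1)%N, rhoI p.2 = prim (rhoI (lam i))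
      & rhoI (lam i) = rhoI p.2 *+ p.1].
have [f fP] : {f & forall i, good i (f i)}.
  apply: choice => i; rewrite /good.
  have [iI|iI] := boolP (i \in I); last by exists (0%N, 0).
  by have [m [z H]] := prim_lambda iI; exists (m, z).
pose m i := if i \in I then (f i).1 else 1%N.
have mE i j : i \in I -> j \in I ->
    (m j)%:R * cc (intvR (f i).2) j = (i == j)%:R.
  move=> iI jI; have [fi0 _ fiE] := fP i iI.
  have := rho_multiple iI jI fiE; rewrite /m jI.
  have [<-//|ij] := eqVneq i j => /eqP.
  by rewrite mulf_eq0 pnatr_eq0 gtn_eqF// => /eqP ->; rewrite mulr0.
exists m; split.
- by move=> i; rewrite /m; case: ifPn => // iI; have [] := fP i iI.
- move=> z i iI.
  pose S := [set q | forall z, rhoI z = q ->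
    exists a : int, (m i)%:R * cc (intvR z) i = a%:~R].
  have : S (rhoI z); last exact.
  apply: (@lambda_face_generate S) => [|j jI].
    split=> [w|x y Sx Sy w wE].
      rewrite -(quotient_proj0 (M_star _ _ _)) -/(rhoI _) => /rho_eq ->//.
      by exists 0; rewrite intv0 char_coord0 mulr0.
    have [zx xE] := quotient_proj_surj x; have [zy yE] := quotient_proj_surj y.
    have /rho_eq -> // : rhoI w = rhoI (zx - zy).
      by rewrite wE -xE -yE -quotient_projB.
    have [a aE] := Sx _ xE; have [b bE] := Sy _ yE.
    by exists (a - b); rewrite intvB char_coordB mulrBr aE bE rmorphB.
  have [_ <- _] := fP j jI => w /rho_eq ->//.
  by rewrite mE//; exists (j == i).
- by move=> i iI; exists (f i).2 => j jI; exact: mE.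
Qed.

End TrivialLocalGroup.
End AngularCoordinates.

(** * Continuity of some elementary maps *)

Section Continuity.
Context {R : realType}.

Lemma continuous_rV {T : topologicalType} m (f : T -> 'rV[R]_m) (t : T) :
  (forall i, f x 0 i @[x --> t] --> f t 0 i) -> f x @[x --> t] --> f t.
Proof.
move=> fl A [P nP PA].
have : \forall x \near t, forall i, P 0 i (f x 0 i).
  by apply: filter_forall => i; exact: fl.
by apply: filterS => x Px; apply: PA => i j; rewrite [i]ord1; exact: Px.
Qed.

Lemma cvg_sumr {T : Type} (F : set_system T) {FF : Filter F} (I : Type)
    (r : seq I) (f : I -> T -> R) (l : I -> R) :
  (forall i, f i @ F --> l i) ->
  \sum_(i <- r) f i x @[x --> F] --> \sum_(i <- r) l i.
Proof.
move=> fl; elim: r => [|i r IH].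
  by rewrite big_nil; under eq_cvg do rewrite big_nil; exact: cvg_cst.
by rewrite big_cons; under eq_cvg do rewrite big_cons; exact: cvgD.
Qed.

Lemma cvg_maxr {T : Type} (F : set_system T) {FF : Filter F}
    (f g : T -> R) a b :
  f @ F --> a -> g @ F --> b -> Num.max (f x) (g x) @[x --> F] --> Num.max a b.
Proof.
move=> fa gb; rewrite maxr_absE.
under eq_cvg do rewrite maxr_absE.
apply: cvgM; last exact: cvg_cst.
apply: cvgD; first exact: cvgD.
by apply: cvg_norm; exact: cvgB.
Qed.

Lemma continuous_dotv m (c : 'rV[R]_m) : continuous (dotv c).
Proof.
move=> x; apply: (@cvg_sumr _ (nbhs x) _ _ _ (fun i y => c 0 i * y 0 i)
  (fun i => c 0 i * x 0 i)) => i; apply: cvgM; first exact: cvg_cst.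
exact: coord_continuous.
Qed.

Lemma continuous_mulmx m p (A : 'M[R]_(m, p)) :
  continuous (fun x : 'rV[R]_m => x *m A).
Proof.
move=> x; apply: continuous_rV => i; rewrite mxE.
under eq_cvg do rewrite mxE.
apply: (@cvg_sumr _ (nbhs x) _ _ _ (fun j y => y 0 j * A j i)
  (fun j => x 0 j * A j i)) => j; apply: cvgM; last exact: cvg_cst.
exact: coord_continuous.
Qed.

End Continuity.

(** * Radial homeomorphisms *)

Section RadialMaps.
Context {R : realType} {n : nat}.
Implicit Types (x y : 'rV[R]_n) (N : 'rV[R]_n -> R).

(** The gauges of the bounded star-shaped neighbourhoods of 0, convex or not. *)
Record radial_gauge N : Prop := {
  gauge_cont : continuous N;
  gauge_ge0 : forall y, 0 <= N y;
  gauge_homog : forall a y, 0 <= a -> N (a *: y) = a * N y;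
  gauge_bound : exists C, forall y i, `|y 0 i| <= C * N y }.

(** The map preserving rays that turns the gauge [N1] into the gauge [N2]. *)
Definition radial N1 N2 y := (N1 y / N2 y) *: y.

Section TwoGauges.
Variables (N1 N2 : 'rV[R]_n -> R).
Hypotheses (gN1 : radial_gauge N1) (gN2 : radial_gauge N2).

Lemma gauge0 N : radial_gauge N -> N 0 = 0.
Proof. by move=> gN; rewrite -(scale0r 0) gauge_homog// mul0r. Qed.

Lemma gauge_eq0 N y : radial_gauge N -> N y = 0 -> y = 0.
Proof.
move=> gN y0; have [C HC] := gauge_bound gN; apply/rowP => i; rewrite mxE.
by apply/eqP; rewrite -normr_le0 (le_trans (HC y i))// y0 mulr0.
Qed.

Lemma gauge_radial y : N2 (radial N1 N2 y) = N1 y.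
Proof.
rewrite /radial gauge_homog ?divr_ge0 ?(gauge_ge0 gN1) ?(gauge_ge0 gN2)//.
have [y0|/mulfVK->//] := eqVneq (N2 y) 0.
by rewrite (gauge_eq0 gN2 y0) !gauge0// mulr0.
Qed.

Lemma radialK : cancel (radial N1 N2) (radial N2 N1).
Proof.
move=> y; rewrite {1}/radial gauge_radial /radial (gauge_homog gN1); last first.
  by rewrite divr_ge0 ?(gauge_ge0 gN1) ?(gauge_ge0 gN2).
have [y0|y0] := eqVneq (N2 y) 0; first by rewrite (gauge_eq0 gN2 y0) !scaler0.
have [y1|y1] := eqVneq (N1 y) 0; first by rewrite (gauge_eq0 gN1 y1) !scaler0.
rewrite scalerA -[RHS]scale1r; congr (_ *: _).
by field; rewrite y0 y1.
Qed.

Lemma continuous_radial : continuous (radial N1 N2).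
Proof.
move=> y; apply: continuous_rV => i; rewrite mxE.
under eq_cvg do rewrite mxE.
have [y0|y0] := eqVneq (N2 y) 0; last first.
  have c1 : N1 x @[x --> y] --> N1 y by exact: gauge_cont.
  have c2 : (N2 x)^-1 @[x --> y] --> (N2 y)^-1.
    have c2 : N2 x @[x --> y] --> N2 y by exact: (gauge_cont gN2).
    exact: cvgV y0 c2.
  exact: cvgM (cvgM c1 c2) (@coord_continuous _ _ _ 0 i y).
(* at the origin, |y_i| <= C N2 y bounds the quotient by C N1 *)
rewrite (gauge_eq0 gN2 y0) mxE mulr0.
have [C HC] := gauge_bound gN2.
have lim0 a : a * N1 x @[x --> (0 : 'rV[R]_n)] --> (0 : R).
  rewrite -[X in _ --> X](mulr0 a) -(gauge0 gN1).
  have c1 : N1 x @[x --> (0 : 'rV[R]_n)] --> N1 0 by exact: (gauge_cont gN1).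
  exact: cvgM (cvg_cst a) c1.
have near_le : \forall x \near (0 : 'rV[R]_n),
    - C * N1 x <= N1 x / N2 x * x 0 i <= C * N1 x; last first.
  exact: squeeze_cvgr near_le _ (lim0 (- C)) (lim0 C).
near=> x; rewrite mulNr -ler_norml normrM normrM normfV.
rewrite (ger0_norm (gauge_ge0 gN1 x)) (ger0_norm (gauge_ge0 gN2 x)).
have [x0|x0] := eqVneq (N2 x) 0.
  by rewrite (gauge_eq0 gN2 x0) !gauge0// !mul0r mulr0.
have x2 : 0 < N2 x by rewrite lt_neqAle eq_sym x0 (gauge_ge0 gN2).
rewrite mulrAC -mulrA [leRHS]mulrC (ler_wpM2l (gauge_ge0 gN1 x))//.
by rewrite ler_pdivrMr//; exact: HC.
Unshelve. all: by end_near. Qed.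

End TwoGauges.

(** Using the absolute values of the coordinates makes the gauge of a bounded
    corner positive away from 0, and so the radial maps homeomorphisms, on the
    whole space instead of the orthant only. *)
Definition absv y : 'rV[R]_n := \row_i `|y 0 i|.

Definition taxicab y := \sum_i `|y 0 i|.

Lemma taxicab_gauge : radial_gauge taxicab.
Proof.
split.
- move=> y; apply: (@cvg_sumr R _ (nbhs y) _ _ _ (fun i y => `|y 0 i|)
    (fun i => `|y 0 i|)) => i; apply: cvg_norm; exact: coord_continuous.
- by move=> y; exact: sumr_ge0.
- move=> a y a0; rewrite /taxicab mulr_sumr; apply: eq_bigr => i _.
  by rewrite mxE normrM ger0_norm.
- exists 1 => y i; rewrite mul1r /taxicab (bigD1 i)//= lerDl.
  exact: sumr_ge0.
Qed.

Section CornerGauge.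
Variables (k : nat) (L : 'I_k -> 'rV[R]_n).

Definition corner_gauge y := \big[Num.max/0]_(j < k) dotv (L j) (absv y).

Lemma dotv_le_gauge y j : dotv (L j) (absv y) <= corner_gauge y.
Proof. exact: (le_bigmax 0 (fun j => dotv (L j) (absv y))). Qed.

Lemma corner_gauge_lt1 y : corner_gauge y < 1 <->
  forall j, dotv (L j) (absv y) < 1.
Proof.
split=> [y1 j|y1]; first exact: le_lt_trans (dotv_le_gauge y j) y1.
by apply: bigmax_lt.
Qed.

Lemma absvE y : (forall i, 0 <= y 0 i) -> absv y = y.
Proof. by move=> y0; apply/rowP => i; rewrite mxE ger0_norm. Qed.

Lemma absv_ge0 y i : 0 <= absv y 0 i.
Proof. by rewrite mxE. Qed.

Lemma corner_gauge_ge0 y : 0 <= corner_gauge y.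
Proof. exact: bigmax_ge_id. Qed.

Lemma corner_gauge_homog a y :
  0 <= a -> corner_gauge (a *: y) = a * corner_gauge y.
Proof.
move=> a0; have absvZ : absv (a *: y) = a *: absv y.
  by apply/rowP => i; rewrite !mxE normrM ger0_norm.
rewrite /corner_gauge absvZ.
under eq_bigr do rewrite dotvZr.
elim/big_rec2: _ => [|j x z _ ->]; first by rewrite mulr0.
by rewrite maxr_pMr.
Qed.

Lemma continuous_corner_gauge : continuous corner_gauge.
Proof.
move=> y; rewrite /corner_gauge.
have H j : dotv (L j) (absv x) @[x --> y] --> dotv (L j) (absv y).
  apply: (@continuous_comp _ _ _ absv (dotv (L j)));
    last exact: continuous_dotv.
  apply: continuous_rV => i; rewrite mxE; under eq_cvg do rewrite mxE.
  exact: (cvg_norm (@coord_continuous R 1 n 0 i y)).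
suff H' s : \big[Num.max/0]_(j <- s) dotv (L j) (absv x) @[x --> y] -->
    \big[Num.max/0]_(j <- s) dotv (L j) (absv y) by exact: H'.
elim: s => [|j s IH].
  rewrite big_nil; under eq_cvg do rewrite big_nil.
  exact: (@cvg_cst _ _ _ (nbhs y)).
rewrite big_cons; under eq_cvg do rewrite big_cons.
exact: (cvg_maxr (H j) IH).
Qed.

(** A bounded corner contains no ray, so its gauge is positive away from 0;
    the bound on the corner gives, by homogeneity, the comparison constant. *)
Lemma corner_gauge_radial (K : R) :
  (forall y, corner L y -> taxicab y <= K) -> radial_gauge corner_gauge.
Proof.
move=> HK; split; [exact: continuous_corner_gauge|exact: corner_gauge_ge0|
  exact: corner_gauge_homog|].
have in_corner y : corner_gauge y <= 1 -> corner L (absv y).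
  move=> y1; split=> [i|j]; first exact: absv_ge0.
  exact: le_trans (dotv_le_gauge y j) y1.
have taxi_abs y : taxicab (absv y) = taxicab y.
  by apply: eq_bigr => i _; rewrite mxE normr_id.
have tg := taxicab_gauge.
suff bd y : taxicab y <= K * corner_gauge y.
  exists K => y i; apply: le_trans (bd y).
  by rewrite /taxicab (bigD1 i)//= lerDl sumr_ge0.
have [y0|y0] := eqVneq (corner_gauge y) 0.
  rewrite y0 mulr0 leNgt; apply/negP => ty.
  (* this multiple of y stays in the corner, too far from 0 *)
  pose a := (`|K| + 1) / taxicab y.
  have a0 : 0 <= a by rewrite divr_ge0 ?addr_ge0// ltW.
  have /HK : corner L (absv (a *: y)).
    by apply: in_corner; rewrite corner_gauge_homog// y0 mulr0.
  rewrite taxi_abs (gauge_homog tg)// /a divfK ?gt_eqF//.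
  by have := ler_norm K; lra.
have yp : 0 < corner_gauge y by rewrite lt_neqAle eq_sym y0 corner_gauge_ge0.
have yV : 0 <= (corner_gauge y)^-1 by rewrite invr_ge0 ltW.
have /HK : corner L (absv ((corner_gauge y)^-1 *: y)).
  by apply: in_corner; rewrite corner_gauge_homog// mulVf.
by rewrite taxi_abs (gauge_homog tg)// ler_pdivrMl// mulrC.
Qed.

End CornerGauge.

Lemma chart_corner_bounded (Q : set 'rV[R]_n) v D k (L : 'I_k -> 'rV[R]_n) :
  vertex_chart Q v D L -> bounded_set Q ->
  exists K, forall y, corner L y -> taxicab y <= K.
Proof.
move=> chartQ [M [_ HM]].
pose M1 := `|M| + 1.
have QM x i : Q x -> `|x 0 i| <= M1.
  move=> Qx; have xM : `|x| <= M1.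
    by apply: (HM M1) => //; rewrite /M1; have := ler_norm M; lra.
  apply: le_trans xM; rewrite [leRHS]/Num.norm /= mx_normrE.
  exact: (le_bigmax 0 (fun p : 'I_1 * 'I_n => `|x p.1 p.2|) (0, i)).
have Qv : Q v by have [] := coord_face_vertex chartQ finset.set0.
exists (\sum_i \sum_l (M1 + M1) * `|D l i|) => y Ly.
rewrite -(pointK chartQ y).
have Qy : Q (point v D y) by apply/(corner_point chartQ).
move: (point v D y) Qy => x Qx.
apply: ler_sum => i _; rewrite /coord mxE (le_trans (ler_norm_sum _ _ _))//.
apply: ler_sum => l _; rewrite normrM ler_wpM2r//.
rewrite [(x - v) 0 l]mxE [(- v) 0 l]mxE.
by rewrite (le_trans (ler_normB _ _))// lerD ?QM.
Qed.

End RadialMaps.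

(** * Polar coordinates in the plane *)

Section PolarCoordinates.
Context {R : realType}.
Implicit Types (a b r x y : R).

Local Notation turn := (2 * pi : R).

(** Angles are counted in turns, so that they match the coordinates of the
    torus $\mathbb{R}^n/\mathbb{Z}^n$. *)
Lemma polar_angle a b r : 0 <= r -> a ^+ 2 + b ^+ 2 = r ^+ 2 ->
  exists2 t, 0 <= t <= 1 & a = r * cos (turn * t) /\ b = r * sin (turn * t).
Proof.
move=> r0 abr; have [r00|rn0] := eqVneq r 0.
  exists 0; first by rewrite lexx ler01.
  move: abr; rewrite r00 expr0n/= => /eqP.
  rewrite paddr_eq0 ?sqr_ge0// !sqrf_eq0 => /andP[/eqP-> /eqP->].
  by rewrite !mul0r.
have rp : 0 < r by rewrite lt_neqAle eq_sym rn0.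
pose c := a / r; pose s := b / r.
have cs : c ^+ 2 + s ^+ 2 = 1.
  by rewrite /c /s !expr_div_n -mulrDl abr divff// expf_neq0.
have c1 : -1 <= c <= 1.
  rewrite -ler_norml -(@ler_pXn2r _ 2)// ?nnegrE// expr1n.
  rewrite real_normK ?num_real//.
  by rewrite -cs lerDl sqr_ge0.
have pi0 := pi_gt0 R.
have turn0 : 0 < turn by rewrite mulr_gt0.
have turn_ge0 := ltW turn0; have t2 := lt0r_neq0 turn0.
have ac0 := acos_ge0 c1; have acp := acos_lepi c1.
have cosac : cos (acos c) = c by rewrite acosK// in_itv.
have sinac : sin (acos c) = `|s|.
  by rewrite sin_acos// -cs addrAC subrr add0r sqrtr_sqr.
have aE : a = r * c by rewrite /c mulrC divfK.
have bE : b = r * s by rewrite /s mulrC divfK.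
have [s0|s0] := leP 0 s.
  exists (acos c / turn).
    rewrite divr_ge0//= ler_pdivrMr// mul1r.
    by lra.
  by rewrite mulrCA mulfV// mulr1 cosac sinac ger0_norm.
exists (1 - acos c / turn).
  rewrite subr_ge0 ler_pdivrMr// mul1r gerBl divr_ge0//.
  by rewrite andbT; lra.
rewrite mulrBr mulr1 mulrCA mulfV// mulr1 mulr_natl addrC.
by rewrite cosD2pi sinD2pi cosN sinN cosac sinac ltr0_norm// opprK.
Qed.

Lemma cosD2pi_int x (z : int) : cos (x + turn * z%:~R) = cos x.
Proof.
rewrite mulr_natl; case: z => m.
  by rewrite -pmulrn mulr_natr (periodicn (@cosD2pi R)).
rewrite NegzE mulrNz mulrN -pmulrn mulr_natr.
by rewrite -[in RHS](subrK (pi *+ 2 *+ m.+1) x) (periodicn (@cosD2pi R)).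
Qed.

Lemma sinD2pi_int x (z : int) : sin (x + turn * z%:~R) = sin x.
Proof.
rewrite mulr_natl; case: z => m.
  by rewrite -pmulrn mulr_natr (periodicn (@sinD2pi R)).
rewrite NegzE mulrNz mulrN -pmulrn mulr_natr.
by rewrite -[in RHS](subrK (pi *+ 2 *+ m.+1) x) (periodicn (@sinD2pi R)).
Qed.

Lemma cos_sin_inj x y : cos (turn * x) = cos (turn * y) ->
  sin (turn * x) = sin (turn * y) -> exists z : int, x - y = z%:~R.
Proof.
move=> cxy sxy; have pi0 := pi_gt0 R.
have t2 : turn != 0 by rewrite lt0r_neq0// mulr_gt0.
pose d := x - y; pose f := d - (Num.floor d)%:~R.
have f01 : 0 <= f < 1.
  have := floor_itv d; rewrite /f => /andP[f0 f1].
  by move: f1; rewrite intrD; lra.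
have cd : cos (turn * f) = 1.
  rewrite /f mulrBr -mulrN -rmorphN cosD2pi_int /d mulrBr cosB cxy sxy.
  by rewrite -!expr2 cos2Dsin2.
suff f0 : f = 0 by exists (Num.floor d); rewrite -/d; move: f0; rewrite /f; lra.
have [f2|f2] := leP (2 * f) 1.
  have : turn * f = 0.
    apply: (@cos_inj R); rewrite ?cos0// in_itv/=.
      by apply/andP; split; nra.
    by rewrite lexx ltW.
  by move=> /eqP; rewrite mulf_eq0 (negbTE t2) => /eqP.
have : turn * (1 - f) = 0.
  apply: (@cos_inj R); rewrite ?cos0// ?in_itv/=.
  - by apply/andP; split; nra.
  - by rewrite lexx ltW.
  - by rewrite mulrBr mulr1 mulr_natl addrC cosD2pi cosN -cd mulr_natl.
move=> /eqP; rewrite mulf_eq0 (negbTE t2) subr_eq0 => /eqP f1.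
by move: f01; rewrite -f1 ltxx andbF.
Qed.

End PolarCoordinates.

(** * Continuous maps out of the torus and the orbifold *)

Section Torus.
Context {R : realType} {n : nat}.
Implicit Types (u w : 'rV[R]_n).

Lemma integer_points_subgroup : is_subgroup (@integer_points R n).
Proof.
split; first by exists 0; rewrite ?intv0.
by move=> _ _ [z _ <-] [w _ <-]; exists (z - w); rewrite ?intvB.
Qed.

Lemma torus_proj_eq u w :
  torus_proj u = torus_proj w <-> exists z : 'rV[int]_n, u - w = intv z.
Proof.
rewrite /torus_proj -/(quotient_proj _ u) -/(quotient_proj _ w).
rewrite quotient_proj_eq.
split=> [|[z uw]]; last by apply: sub_gen_subgroup; exists z.
move=> /(gen_subgroup_min integer_points_subgroup (fun _ h => h))[z _ <-].
by exists z.
Qed.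

Lemma torus_projB u w : torus_proj (u - w) = torus_proj u - torus_proj w.
Proof. by rewrite /torus_proj !piE. Qed.

Lemma torus_proj_surj (t : torus R n) : exists u, torus_proj u = t.
Proof. by exists (repr t); rewrite /torus_proj reprK. Qed.

Lemma continuous_torus_proj : continuous (@torus_proj R n).
Proof. exact: pi_continuous. Qed.

Lemma continuous_torus_lift (Z : topologicalType) (g : 'rV[R]_n -> Z) :
  continuous g -> (forall u (z : 'rV[int]_n), g (u + intv z) = g u) ->
  exists2 h : torus R n -> Z, continuous h & forall u, h (torus_proj u) = g u.
Proof.
move=> cg gz; have inv u w : torus_proj u = torus_proj w -> g u = g w.
  by move=> /torus_proj_eq[z uw]; rewrite -(gz w z) -uw addrC subrK.
exists (g \o repr : torus R n -> Z).
  apply: repr_comp_continuous => // u w /eqP uw; apply/eqP; exact: inv.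
by move=> u /=; apply: inv; rewrite /torus_proj reprK.
Qed.

End Torus.

Section Orbifold.
Context {R : realType} {n : nat}.
Variables (Q : set 'rV[R]_n) (lambda : set 'rV[R]_n -> 'rV[int]_n).
Local Notation T := (torus R n).
Local Notation X := (toric_orbifold Q lambda).
Local Notation proj := (@toric_proj R n Q lambda).

Lemma toric_proj_eq (t s : T) (x y : set_type Q) :
  proj (t, x) = proj (s, y) <->
  x = y /\ subtorus Q lambda (min_face Q (set_val x)) (t - s).
Proof.
split=> [/(@eqquotP _ (@orbit_rel_equiv_rel R n Q lambda))/asboolP//|xy].
by apply/(@eqquotP _ (@orbit_rel_equiv_rel R n Q lambda))/asboolP.
Qed.

Lemma toric_reprK (p : X) : proj (toric_repr p) = p.
Proof. by rewrite /toric_proj /toric_repr reprK. Qed.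

Lemma toric_repr_base (t : T) (x : set_type Q) :
  (toric_repr (proj (t, x))).2 = x.
Proof.
have := toric_reprK (proj (t, x)).
by case: (toric_repr _) => s y /= /toric_proj_eq[].
Qed.

Lemma continuous_toric_proj : continuous proj.
Proof. exact: pi_continuous. Qed.

Lemma continuous_toric_lift (Z : topologicalType) (g : T * set_type Q -> Z) :
  continuous g ->
  (forall t s x, subtorus Q lambda (min_face Q (set_val x)) (t - s) ->
    g (t, x) = g (s, x)) ->
  exists2 h : X -> Z, continuous h & forall p, h (proj p) = g p.
Proof.
move=> cg gE; have inv p q : proj p = proj q -> g p = g q.
  by case: p q => [t x] [s y] /toric_proj_eq[<-]; exact: gE.
exists (g \o (@toric_repr R n Q lambda)).
  apply: repr_comp_continuous => // p q /eqP pq; apply/eqP; exact: inv.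
by move=> p /=; apply: inv; rewrite toric_reprK.
Qed.

End Orbifold.

(** * The part of the orbifold over an open star is a disc *)

Section Cell.
Context {R : realType} {n : nat}.
Variables (Q : set 'rV[R]_n) (lambda : set 'rV[R]_n -> 'rV[int]_n).
Variables (v : 'rV[R]_n) (D : 'M[R]_n) (k : nat) (L : 'I_k -> 'rV[R]_n).
Hypotheses (chartQ : vertex_chart Q v D L).
Hypothesis charQ : characteristic_function Q lambda.
Hypothesis gaugeL : radial_gauge (corner_gauge L).
Variables (I : {set 'I_n}) (m : 'I_n -> nat).
Hypothesis faceI : face Q (coord_face Q v D I).
Local Notation cd := (coord v D).
Local Notation cface := (coord_face Q v D I).
Local Notation cwall := (coord_wall Q v D).
Local Notation cc := (char_coord lambda Q v D).
Hypothesis m_gt0 : forall i, (0 < m i)%N.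
Hypothesis m_int : forall z i, i \in I ->
  exists a : int, (m i)%:R * cc (intv z) i = a%:~R.
Hypothesis m_dual : forall i, i \in I -> exists z,
  forall j, j \in I -> (m j)%:R * cc (intv z) j = (i == j)%:R.
Implicit Types (x u : 'rV[R]_n) (i : 'I_n).

(** The coordinate of the torus in which a full turn is 1. *)
Definition angle lambda Q v D (m : 'I_n -> nat) u i : R :=
  (m i)%:R * char_coord lambda Q v D u i.
Local Notation ang := (angle lambda Q v D m).

Lemma angleB u w i : ang (u - w) i = ang u i - ang w i.
Proof. by rewrite /angle char_coordB mulrBr. Qed.

Definition inner x := Q x /\ forall j, dotv (L j) (cd x) < 1.

(** The subtorus of [x] is a coordinate subspace, on which the angles at the
    coordinates not vanishing at [x] are 0; so these angles are well defined
    modulo 1 on the orbifold. *)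
Lemma subtorus_angle x u w i : inner x -> i \in I -> cd x 0 i != 0 ->
  subtorus Q lambda (min_face Q x) (torus_proj u - torus_proj w) ->
  exists a : int, ang u i - ang w i = a%:~R.
Proof.
move=> [Qx Lx] iI xi [y My]; rewrite -torus_projB => /torus_proj_eq[z yz].
have [a az] := m_int z iI; exists (- a).
have := M_real_min_face chartQ charQ y Qx Lx => -[/(_ My) /(_ i xi) yi _].
rewrite -angleB -[u - w](subKr y) yz angleB /angle yi mulr0 sub0r az.
by rewrite rmorphN.
Qed.

(** If the angles of a vector are integral, subtracting the integral
    combination of the vectors of [m_dual] with the same angles leaves a
    vector spanned by the characteristic vectors of the walls through [x]. *)
Lemma angle_subtorus x u w : inner x -> cface x ->
  (forall i, i \in I -> cd x 0 i != 0 ->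
    exists a : int, ang u i - ang w i = a%:~R) ->
  subtorus Q lambda (min_face Q x) (torus_proj u - torus_proj w).
Proof.
move=> [Qx Lx] [_ xI] uw; rewrite -torus_projB.
pose turns i (a : int) := i \in I -> cd x 0 i != 0 -> ang u i - ang w i = a%:~R.
have [a aE] : {a & forall i, turns i (a i)}.
  apply: choice => i; rewrite /turns.
  have [iI|iI] := boolP (i \in I); last by exists 0.
  have [xi|xi] := eqVneq (cd x 0 i) 0; first by exists 0.
  by have [a aE] := uw i iI xi; exists a.
pose dual i (z : 'rV[int]_n) := i \in I -> forall j, j \in I ->
  ang (intv z) j = (i == j)%:R.
have [p pE] : {p & forall i, dual i (p i)}.
  apply: choice => i; rewrite /dual.
  have [iI|iI] := boolP (i \in I); last by exists 0.
  by have [z zE] := m_dual iI; exists z.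
(* the integral vector with the same angles as u - w away from the walls of x *)
pose b i : int := if (i \in I) && (cd x 0 i != 0) then a i else 0.
pose z := \sum_i b i *: p i.
have intvz : intv z = \sum_i (b i)%:~R *: intv (p i) :> 'rV[R]_n.
  rewrite /z /intv raddf_sum; apply: eq_bigr => i _.
  by apply/rowP => j; rewrite !mxE; exact: intrM.
exists (u - w - intv z); last first.
  apply/torus_proj_eq; exists (- z).
  by rewrite -[- z]sub0r intvB intv0 sub0r addrAC subrr add0r.
apply/(M_real_min_face chartQ charQ _ Qx Lx) => i xi.
have iI : i \in I by apply: contraNT xi => /xI/= ->.
have mi : (m i)%:R != 0 :> R by rewrite pnatr_eq0 gtn_eqF.
apply: (mulfI mi); rewrite mulr0 -/(ang _ i) !angleB aE//.
rewrite intvz /angle char_coord_sum mulr_sumr.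
rewrite (bigD1 i)//= big1 ?addr0 => [|j ji].
  rewrite char_coordZ mulrCA -/(ang _ i) pE// eqxx mulr1 /b iI xi/=.
  by rewrite subrr.
rewrite char_coordZ mulrCA -/(ang _ i) /b.
case: ifPn => [/andP[jI _]|_]; last by rewrite mul0r.
by rewrite pE// (negbTE ji) mulr0.
Qed.

Local Notation turn := (2 * pi : R).
Local Notation s := #|I|.

(** The squared moduli of the complex coordinates over [x]: the radial map
    carries the open star, where [corner_gauge L (cd x) < 1], to the part of
    the orthant where the coordinates add up to less than 1. *)
Definition radius2 (L : 'I_k -> 'rV[R]_n) v D x : 'rV[R]_n :=
  radial (corner_gauge L) taxicab (coord v D x).
Local Notation r2 := (radius2 L v D).

Lemma radius2_ge0 x i : Q x -> 0 <= r2 x 0 i.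
Proof.
move=> Qx; rewrite mxE mulr_ge0 ?(coord_ge0 chartQ)//.
by rewrite divr_ge0 ?(gauge_ge0 gaugeL)// (gauge_ge0 taxicab_gauge).
Qed.

Lemma radius2_coord0 x i : cd x 0 i = 0 -> r2 x 0 i = 0.
Proof. by move=> xi; rewrite mxE xi mulr0. Qed.

Lemma taxicab_radius2 x : taxicab (r2 x) = corner_gauge L (cd x).
Proof. exact: gauge_radial gaugeL taxicab_gauge _. Qed.

Definition modulus (L : 'I_k -> 'rV[R]_n) v D x i : R :=
  Num.sqrt (radius2 L v D x 0 i).
Local Notation md := (modulus L v D).

Lemma continuous_coord : continuous cd.
Proof.
move=> x; have c1 : y - v @[y --> x] --> x - v.
  exact: cvgB (@cvg_id _ (nbhs x)) (@cvg_cst _ v _ (nbhs x) _).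
exact: cvg_comp c1 (@continuous_mulmx _ _ _ D (x - v)).
Qed.

Lemma continuous_modulus i : continuous (fun x => md x i).
Proof.
move=> x.
apply: (@continuous_comp _ _ _ (fun x => r2 x 0 i) Num.sqrt);
  last exact: sqrt_continuous.
apply: (@continuous_comp _ _ _ r2 (fun y : 'rV[R]_n => y 0 i));
  last exact: coord_continuous.
apply: (@continuous_comp _ _ _ cd (radial (corner_gauge L) taxicab)).
  exact: continuous_coord.
exact: continuous_radial gaugeL taxicab_gauge _.
Qed.

(** Vanishes on the facets of [Q] that miss [v], but nowhere on the star. *)
Definition slack (L : 'I_k -> 'rV[R]_n) v D x : R :=
  \prod_(j < k) (1 - dotv (L j) (coord v D x)).
Local Notation sl := (slack L v D).

Lemma slack_neq0 x : Q x -> sl x != 0 <-> inner x.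
Proof.
move=> Qx; split=> [/prodf_neq0 H|[_ Lx]].
  split=> // j; have [_ /(_ j) Lj] := (corner_coord chartQ x).1 Qx.
  by rewrite lt_neqAle Lj andbT; have := H j isT; rewrite subr_eq0 eq_sym.
by apply/prodf_neq0 => j _; rewrite subr_eq0 gt_eqF.
Qed.

Lemma continuous_slack : continuous sl.
Proof.
move=> x; rewrite /slack.
suff H (r : seq 'I_k) : \prod_(j <- r) (1 - dotv (L j) (cd y)) @[y --> x] -->
    \prod_(j <- r) (1 - dotv (L j) (cd x)) by exact: H.
elim: r => [|j r IH].
  rewrite big_nil; under eq_cvg do rewrite big_nil.
  exact: (@cvg_cst _ _ _ (nbhs x)).
rewrite big_cons; under eq_cvg do rewrite big_cons.
have c1 : dotv (L j) (cd y) @[y --> x] --> dotv (L j) (cd x).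
  apply: (@continuous_comp _ _ _ cd (dotv (L j)));
    first exact: continuous_coord.
  exact: continuous_dotv.
have c2 : 1 - dotv (L j) (cd y) @[y --> x] --> 1 - dotv (L j) (cd x).
  exact: cvgB (@cvg_cst _ (1 : R) _ (nbhs x) _) c1.
exact: cvgM c2 IH.
Qed.

Lemma continuous_angle i : continuous (fun u => ang u i).
Proof.
move=> u; have c1 : cc w i @[w --> u] --> cc u i.
  exact: cvg_comp (@continuous_mulmx _ _ _ _ u) (@coord_continuous _ _ _ 0 i _).
rewrite /angle; exact: cvgM (@cvg_cst R ((m i)%:R : R) _ (nbhs u) _) c1.
Qed.

(** The cell carries the topology of a subspace of a quotient, so continuous
    maps on it are obtained by restriction from the whole orbifold. Away from
    the open star an angle is not invariant under the identifications, but
    there the slack vanishes; and where the modulus vanishes, so does the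
    wave. *)
Lemma weighted_wave i (c : R -> R) : i \in I -> continuous c ->
  (forall a (z : int), c (a + turn * z%:~R) = c a) ->
  exists2 h : toric_orbifold Q lambda -> R, continuous h &
    forall u (x : set_type Q), h (toric_proj lambda (torus_proj u, x)) =
      sl (set_val x) * (md (set_val x) i * c (turn * ang u i)).
Proof.
move=> iI cc_ cper.
have [||c' cc' c'E] :=
  @continuous_torus_lift R n _ (fun u => c (turn * ang u i)).
- move=> u; apply: (@continuous_comp _ _ _ (fun u => turn * ang u i) c);
    last exact: cc_.
  have c1 : ang w i @[w --> u] --> ang u i by exact: continuous_angle.
  exact: cvgM (@cvg_cst _ _ _ (nbhs u) _) c1.
- move=> u z; have [a az] := m_int z iI.
  have -> : ang (u + intv z) i = ang u i + a%:~R.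
    by rewrite -az /angle char_coordD mulrDr.
  by rewrite mulrDr cper.
have valc : continuous (set_val : set_type Q -> 'rV[R]_n).
  exact: initial_continuous.
pose g (p : torus R n * set_type Q) :=
  sl (set_val p.2) * (md (set_val p.2) i * c' p.1).
have [||h ch hE] := @continuous_toric_lift R n Q lambda _ g.
- move=> p; rewrite /g.
  have c2 : set_val q.2 @[q --> p] --> set_val p.2.
    apply: (@continuous_comp _ _ _ (snd : torus R n * set_type Q -> _) set_val).
      exact: cvg_snd.
    exact: valc.
  have c3 : sl (set_val q.2) @[q --> p] --> sl (set_val p.2).
    exact: cvg_comp c2 (@continuous_slack _).
  have c4 : md (set_val q.2) i @[q --> p] --> md (set_val p.2) i.
    exact: cvg_comp c2 (@continuous_modulus i _).
  have c5 : c' q.1 @[q --> p] --> c' p.1.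
    apply: (@continuous_comp _ _ _ (fst : torus R n * set_type Q -> _) c').
      exact: cvg_fst.
    exact: cc'.
  exact: cvgM c3 (cvgM c4 c5).
- move=> t t' x; have [u <-] := torus_proj_surj t.
  have [w <-] := torus_proj_surj t'.
  rewrite /g /= => uw.
  have Qx : Q (set_val x) by exact: set_valP.
  have [->|sx] := eqVneq (sl (set_val x)) 0; first by rewrite !mul0r.
  have [x0|x0] := eqVneq (cd (set_val x) 0 i) 0.
    by rewrite /modulus radius2_coord0// sqrtr0 !mul0r.
  have [a aE] := subtorus_angle ((slack_neq0 Qx).1 sx) iI x0 uw.
  by rewrite !c'E -[ang u i](subrK (ang w i)) aE addrC mulrDr cper.
by exists h => // u x; rewrite hE /g /= c'E.
Qed.

Implicit Types (w : 'rV[R]_(s + s)) (phi : 'rV[R]_s) (rr y : 'rV[R]_n).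

(** The squared moduli of the points of $\mathbb{C}^{I}$, encoded as [row_mx]
    of the real and the imaginary parts, and extended by 0 outside of [I]. *)
Definition sqnorms (I : {set 'I_n}) (w : 'rV[R]_(#|I| + #|I|)) : 'rV[R]_n :=
  \row_i \sum_(r < #|I| | enum_val r == i)
    (w 0 (lshift _ r) ^+ 2 + w 0 (rshift _ r) ^+ 2).
Local Notation sq := (@sqnorms I).

Definition polar (I : {set 'I_n}) rr (phi : 'rV[R]_#|I|) :
    'rV[R]_(#|I| + #|I|) :=
  row_mx (\row_r (Num.sqrt (rr 0 (enum_val r)) * cos (turn * phi 0 r)))
         (\row_r (Num.sqrt (rr 0 (enum_val r)) * sin (turn * phi 0 r))).
Local Notation pol := (@polar I).

Lemma polar_cos rr phi (r : 'I_s) : pol rr phi 0 (lshift s r) =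
  Num.sqrt (rr 0 (enum_val r)) * cos (turn * phi 0 r).
Proof. by rewrite row_mxEl mxE. Qed.

Lemma polar_sin rr phi (r : 'I_s) : pol rr phi 0 (rshift s r) =
  Num.sqrt (rr 0 (enum_val r)) * sin (turn * phi 0 r).
Proof. by rewrite row_mxEr mxE. Qed.

Lemma sqnorms_val w (r : 'I_s) :
  sq w 0 (enum_val r) = w 0 (lshift _ r) ^+ 2 + w 0 (rshift _ r) ^+ 2.
Proof.
by rewrite mxE (big_pred1 r)// => r'; rewrite (inj_eq enum_val_inj).
Qed.

Lemma sqnorms_notin w i : i \notin I -> sq w 0 i = 0.
Proof.
move=> iI; rewrite mxE big1// => r /eqP ri.
by rewrite -ri enum_valP in iI.
Qed.

Lemma sqnorms_ge0 w i : 0 <= sq w 0 i.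
Proof. by rewrite mxE sumr_ge0// => r _; rewrite addr_ge0// sqr_ge0. Qed.

Lemma taxicab_sqnorms w : taxicab (sq w) = dotv w w.
Proof.
transitivity (\sum_i sq w 0 i).
  by apply: eq_bigr => i _; rewrite ger0_norm ?sqnorms_ge0.
rewrite /dotv big_split_ord/= -big_split/=.
rewrite [RHS](partition_big (fun r : 'I_s => enum_val r) predT)//=.
by apply: eq_bigr => i _; rewrite mxE.
Qed.

Lemma continuous_sqnorms : continuous sq.
Proof.
move=> w; apply: continuous_rV => i.
have sqE w' : sq w' 0 i = \sum_(r < s) if enum_val r == i
    then w' 0 (lshift _ r) ^+ 2 + w' 0 (rshift _ r) ^+ 2 else 0.
  by rewrite mxE big_mkcond.
rewrite sqE; under eq_cvg do rewrite sqE.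
have c1 j : (w' : 'rV[R]_(s + s)) 0 j @[w' --> w] --> w 0 j.
  exact: coord_continuous.
have c2 j : (w' : 'rV[R]_(s + s)) 0 j ^+ 2 @[w' --> w] --> w 0 j ^+ 2.
  rewrite expr2; under eq_cvg do rewrite expr2.
  exact: cvgM (c1 j) (c1 j).
apply: (@cvg_sumr R _ (nbhs w) _ _ _
  (fun (r : 'I_s) (w' : 'rV[R]_(s + s)) => if enum_val r == i
     then w' 0 (lshift _ r) ^+ 2 + w' 0 (rshift _ r) ^+ 2 else 0)
  (fun r : 'I_s => if enum_val r == i
     then w 0 (lshift _ r) ^+ 2 + w 0 (rshift _ r) ^+ 2 else 0)) => r.
case: ifP => _; last exact: (@cvg_cst _ _ _ (nbhs w)).
exact: cvgD (c2 _) (c2 _).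
Qed.

Lemma sqnorms_polar rr phi : (forall i, 0 <= rr 0 i) ->
  (forall i, i \notin I -> rr 0 i = 0) -> sq (pol rr phi) = rr.
Proof.
move=> rr0 rrI; apply/rowP => i; have [iI|iI] := boolP (i \in I); last first.
  by rewrite sqnorms_notin// rrI.
rewrite -(enum_rankK_in iI iI) sqnorms_val row_mxEl row_mxEr !mxE.
by rewrite !exprMn -mulrDr cos2Dsin2 mulr1 sqr_sqrtr.
Qed.

Lemma exists_polar w :
  exists2 phi : 'rV[R]_s, (forall r, 0 <= phi 0 r <= 1) & w = pol (sq w) phi.
Proof.
pose ok r (t : R) := 0 <= t <= 1 /\
  w 0 (lshift s r) = Num.sqrt (sq w 0 (enum_val r)) * cos (turn * t) /\
  w 0 (rshift s r) = Num.sqrt (sq w 0 (enum_val r)) * sin (turn * t).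
have [f fP] : {f & forall r, ok r (f r)}.
  apply: choice => r; have [||t t01 tE] := @polar_angle R (w 0 (lshift s r))
    (w 0 (rshift s r)) (Num.sqrt (sq w 0 (enum_val r))).
  - exact: sqrtr_ge0.
  - by rewrite sqr_sqrtr ?sqnorms_ge0// sqnorms_val.
  - by exists t.
exists (\row_r f r) => [r|]; first by rewrite mxE; exact: (fP r).1.
rewrite -[LHS]hsubmxK; congr row_mx; apply/rowP => r;
  rewrite [LHS]mxE [RHS]mxE [(\row_r0 f r0) 0 r]mxE.
  exact: (fP r).2.1.
exact: (fP r).2.2.
Qed.

Lemma continuous_polar :
  continuous (fun p : 'rV[R]_s * 'rV[R]_(s + s) => pol (sq p.2) p.1).
Proof.
pose PT := ('rV[R]_s * 'rV[R]_(s + s))%type.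
have wave (c : R -> R) (r : 'I_s) : continuous c ->
    continuous (fun p : PT =>
      Num.sqrt (sq p.2 0 (enum_val r)) * c (turn * p.1 0 r)).
  move=> cc_ p0.
  have c1 : sq (p : PT).2 @[p --> p0] --> sq p0.2.
    exact: cvg_comp (@cvg_snd _ _ (nbhs p0.1) (nbhs p0.2) _)
      (@continuous_sqnorms p0.2).
  have c2 : sq (p : PT).2 0 (enum_val r) @[p --> p0] --> sq p0.2 0 (enum_val r).
    exact: cvg_comp c1 (@coord_continuous _ _ _ 0 (enum_val r) (sq p0.2)).
  have c3 : Num.sqrt (sq (p : PT).2 0 (enum_val r)) @[p --> p0] -->
      Num.sqrt (sq p0.2 0 (enum_val r)).
    exact: cvg_comp c2 (@sqrt_continuous _ _).
  have c4 : (p : PT).1 0 r @[p --> p0] --> p0.1 0 r.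
    exact: cvg_comp (@cvg_fst _ _ (nbhs p0.1) (nbhs p0.2) _)
      (@coord_continuous _ _ _ 0 r p0.1).
  have c5 : turn * (p : PT).1 0 r @[p --> p0] --> turn * p0.1 0 r.
    exact: cvgM (@cvg_cst _ turn _ (nbhs p0) _) c4.
  exact: cvgM c3 (cvg_comp _ _ c5 (cc_ _)).
move=> p0; apply: continuous_rV => j; rewrite -(splitK j).
case: (fintype.split j) => r /=.
  rewrite polar_cos; under eq_cvg do rewrite polar_cos.
  exact: (wave _ r (@continuous_cos R) p0).
rewrite polar_sin; under eq_cvg do rewrite polar_sin.
exact: (wave _ r (@continuous_sin R) p0).
Qed.

(** Retracts the orthant onto the corner, so that [disc_base] has values in
    [Q] on the whole space. *)
Definition clamp (L : 'I_k -> 'rV[R]_n) y : 'rV[R]_n :=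
  (Num.max 1 (corner_gauge L y))^-1 *: y.

Definition disc_base (L : 'I_k -> 'rV[R]_n) v D (I : {set 'I_n})
    (w : 'rV[R]_(#|I| + #|I|)) : 'rV[R]_n :=
  point v D (clamp L (radial taxicab (corner_gauge L) (@sqnorms I w))).
Local Notation base := (@disc_base L v D I).

Lemma max1_gt0 (a : R) : 0 < Num.max 1 a.
Proof. by rewrite lt_max ltr01. Qed.

Lemma radial_sqnorms_ge0 w i : 0 <= radial taxicab (corner_gauge L) (sq w) 0 i.
Proof.
rewrite mxE mulr_ge0 ?sqnorms_ge0// divr_ge0 ?(gauge_ge0 gaugeL)//.
exact: (gauge_ge0 taxicab_gauge).
Qed.

Lemma disc_base_in w : Q (base w).
Proof.
apply/(corner_point chartQ); set y := radial _ _ _.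
have y0 i : 0 <= y 0 i by exact: radial_sqnorms_ge0.
split=> [i|j]; first by rewrite mxE mulr_ge0// invr_ge0 (ltW (max1_gt0 _)).
rewrite dotvZr ler_pdivrMl ?max1_gt0// mulr1 le_max.
by have := dotv_le_gauge L y j; rewrite (absvE y0) => ->; rewrite orbT.
Qed.

Lemma continuous_disc_base : continuous base.
Proof.
move=> w.
have c1 : radial taxicab (corner_gauge L) (sq w') @[w' --> w] -->
    radial taxicab (corner_gauge L) (sq w).
  exact: cvg_comp (@continuous_sqnorms w)
    (@continuous_radial _ _ _ _ taxicab_gauge gaugeL (sq w)).
have clampc y : clamp L y' @[y' --> y] --> clamp L y.
  apply: continuous_rV => i; rewrite mxE; under eq_cvg do rewrite mxE.
  have d1 : corner_gauge L y' @[y' --> y] --> corner_gauge L y.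
    exact: gauge_cont gaugeL y.
  have d2 : Num.max 1 (corner_gauge L y') @[y' --> y] -->
      Num.max 1 (corner_gauge L y).
    exact: cvg_maxr (@cvg_cst _ (1 : R) _ (nbhs y) _) d1.
  exact: cvgM (cvgV (lt0r_neq0 (max1_gt0 _)) d2)
    (@coord_continuous _ _ _ 0 i y).
have c2 := cvg_comp _ _ c1 (clampc _).
have c3 := cvg_comp _ _ c2 (@continuous_mulmx _ _ _ (invmx D) _).
exact: cvgD (@cvg_cst _ v _ (nbhs w) _) c3.
Qed.

Lemma disc_base_star w : @open_disc R (s + s) w ->
  [/\ inner (base w), cface (base w) & r2 (base w) = sq w].
Proof.
rewrite /open_disc /= -taxicab_sqnorms => w1.
have gN := @taxicab_gauge R n.
have N1 : corner_gauge L (radial taxicab (corner_gauge L) (sq w)) < 1.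
  by rewrite (gauge_radial gN gaugeL).
have baseE : cd (base w) = radial taxicab (corner_gauge L) (sq w).
  by rewrite (pointK chartQ) /clamp (max_l (ltW N1)) invr1 scale1r.
split.
- split; first exact: disc_base_in.
  move=> j; rewrite baseE -(absvE (radial_sqnorms_ge0 w)).
  by move: j; apply/corner_gauge_lt1.
- split; first exact: disc_base_in.
  by move=> i iI; rewrite baseE mxE sqnorms_notin// mulr0.
- by rewrite /radius2 baseE (radialK gN gaugeL).
Qed.

Lemma disc_base_radius2 w x : inner x -> cface x -> sq w = r2 x -> base w = x.
Proof.
move=> [Qx Lx] _ sqE; rewrite /disc_base sqE (radialK gaugeL taxicab_gauge).
have N1 : corner_gauge L (cd x) < 1.
  apply/corner_gauge_lt1 => j.
  by rewrite absvE// => i; exact: (coord_ge0 chartQ).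
by rewrite /clamp (max_l (ltW N1)) invr1 scale1r (coordK chartQ).
Qed.

Definition angle_lift (lambda : set 'rV[R]_n -> 'rV[int]_n)
    (Q : set 'rV[R]_n) (v : 'rV[R]_n) (D : 'M[R]_n)
    (m : 'I_n -> nat) (I : {set 'I_n}) (phi : 'rV[R]_#|I|) : 'rV[R]_n :=
  phi *m \matrix_(r < #|I|)
    ((m (enum_val r))%:R^-1 *: intv (lambda (coord_wall Q v D (enum_val r)))).
Local Notation lift := (@angle_lift lambda Q v D m I).

Lemma angle_liftE phi (r : 'I_s) : ang (lift phi) (enum_val r) = phi 0 r.
Proof.
have mr : (m (enum_val r))%:R != 0 :> R by rewrite pnatr_eq0 gtn_eqF.
rewrite /angle /angle_lift mulmx_sum_row char_coord_sum.
rewrite (bigD1 r)//= big1 ?addr0.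
  rewrite char_coordZ rowK char_coordZ (char_coord_lambda chartQ charQ)//.
  rewrite eqxx mulr1.
  by rewrite mulrCA mulfV// mulr1.
move=> r' rr'; rewrite char_coordZ rowK char_coordZ.
rewrite (char_coord_lambda chartQ charQ)//.
by rewrite (inj_eq enum_val_inj) (negbTE rr') !mulr0.
Qed.

Definition base_point w : set_type Q :=
  exist _ (base w) (mem_set (disc_base_in w)).

(** The inverse of the polar map, as a function of a point of the disc
    together with a choice of its angles. *)
Definition unroll (p : 'rV[R]_s * 'rV[R]_(s + s)) : toric_orbifold Q lambda :=
  toric_proj lambda (torus_proj (lift p.1), base_point p.2).

Lemma continuous_unroll : continuous unroll.
Proof.
move=> p.
pose PT := ('rV[R]_s * 'rV[R]_(s + s))%type.
have d1 : lift (q : PT).1 @[q --> p] --> lift p.1.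
  exact: cvg_comp (@cvg_fst _ _ (nbhs p.1) (nbhs p.2) _)
    (@continuous_mulmx R _ _ _ p.1).
have c1 : torus_proj (lift (q : PT).1) @[q --> p] --> torus_proj (lift p.1).
  exact: cvg_comp d1 (@continuous_torus_proj R n _).
have cb : continuous base_point.
  apply: continuous_comp_initial; exact: continuous_disc_base.
have c2 : base_point (q : PT).2 @[q --> p] --> base_point p.2.
  exact: cvg_comp (@cvg_snd _ _ (nbhs p.1) (nbhs p.2) _) (cb _).
apply: (@continuous_comp _ _ _
  (fun q : PT => (torus_proj (lift q.1), base_point q.2))
  (@toric_proj R n Q lambda)); last exact: continuous_toric_proj.
exact: cvg_pair c1 c2.
Qed.

Definition cell_of (P : set 'rV[R]_n) (v : 'rV[R]_n) :
    set (toric_orbifold Q lambda) :=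
  [set p | open_star Q P v (set_val (toric_repr p).2)].

Lemma open_star_inner x : open_star Q cface v x <-> cface x /\ inner x.
Proof.
rewrite (open_starE chartQ)//; split=> [[Ix Lx]|[Ix [_ Lx]]]; split=> //.
by split=> //; case: Ix.
Qed.

Lemma cell_of_proj p : cell_of cface v p -> exists u (x : set_type Q),
  [/\ p = toric_proj lambda (torus_proj u, x), inner (set_val x)
    & cface (set_val x)].
Proof.
move=> pC; have [Ix inx] := (open_star_inner _).1 pC.
move: (toric_reprK p) Ix inx; case: (toric_repr p) => t x/= pE Ix inx.
have [u uE] := torus_proj_surj t.
by exists u, x; rewrite uE pE.
Qed.

(** Over [x], the polar form determines the angles modulo 1 at the coordinates
    that do not vanish at [x], and the others are collapsed by the subtorus of
    [x]. *)
Lemma polar_collision u x phi : inner x -> cface x ->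
  pol (r2 x) (\row_r ang u (enum_val r)) = pol (r2 x) phi ->
  subtorus Q lambda (min_face Q x) (torus_proj u - torus_proj (lift phi)).
Proof.
move=> inx Ix polE; apply: angle_subtorus => // i iI xi.
have [Qx _] := inx.
have ri0 : r2 x 0 i != 0.
  apply/eqP => r0; case/eqP: xi.
  have /(congr1 (fun y : 'rV[R]_n => y 0 i)) :=
    radialK gaugeL taxicab_gauge (cd x).
  by rewrite mxE -/(r2 x) r0 mulr0 => <-.
have ri : Num.sqrt (r2 x 0 i) != 0.
  by rewrite gt_eqF// sqrtr_gt0 lt_neqAle eq_sym ri0 radius2_ge0.
pose r := enum_rank_in iI i; have ir : i = enum_val r by rewrite enum_rankK_in.
rewrite ir in ri; rewrite ir angle_liftE.
have := congr1 (fun w : 'rV[R]_(s + s) => w 0 (lshift s r)) polE.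
have := congr1 (fun w : 'rV[R]_(s + s) => w 0 (rshift s r)) polE.
rewrite /= !polar_cos !polar_sin [(\row_r0 _) 0 r]mxE.
by move=> /(mulfI ri) sE /(mulfI ri) cE; exact: cos_sin_inj cE sE.
Qed.

Definition cube : set 'rV[R]_s :=
  [set phi | forall r, `[0, 1]%classic (phi 0 r)].

Lemma compact_cube : compact cube.
Proof.
apply: (@rV_compact R s (fun=> `[0, 1]%classic)) => r.
exact: segment_compact.
Qed.

Lemma unroll_unique w phi psi : @open_disc R (s + s) w ->
  w = pol (sq w) phi -> w = pol (sq w) psi -> unroll (phi, w) = unroll (psi, w).
Proof.
move=> w1 wphi wpsi; have [inx Ix rE] := disc_base_star w1.
apply/toric_proj_eq; split=> //=; apply: polar_collision => //; rewrite rE.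
have -> : \row_r ang (lift phi) (enum_val r) = phi.
  by apply/rowP => r; rewrite mxE angle_liftE.
by rewrite -wphi.
Qed.

(** The angles of [w] cannot be chosen continuously, but they stay in the
    compact cube. Each point of the cube has a neighbourhood where, for [w']
    close to [w], either [unroll] is close to its value at [w], or the angles
    are not those of [w']; compactness makes the choice of the angles
    irrelevant. *)
Lemma continuous_unroll_angles (a : 'rV[R]_(s + s) -> 'rV[R]_s) w :
  (forall w', cube (a w') /\ w' = pol (sq w') (a w')) ->
  @open_disc R (s + s) w ->
  {for w, continuous (fun w' => unroll (a w', w'))}.
Proof.
move=> aP w1 O Og; pose PT := ('rV[R]_s * 'rV[R]_(s + s))%type.
have near_all phi : cube phi -> \forall phi' \near phi & w' \near w,
    w' = pol (sq w') phi' -> O (unroll (phi', w')).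
  move=> _; have [wE|wE] := eqVneq w (pol (sq w) phi).
    have Ou : nbhs (unroll (phi, w)) O.
      by rewrite (unroll_unique w1 wE (aP w).2).
    have nO : nbhs (phi, w) (unroll @^-1` O) by exact: continuous_unroll Ou.
    by apply: (@filterS _ (nbhs (phi, w)) _ _ _ _ nO) => -[phi' w'].
  have [j wj] : exists j, w 0 j != pol (sq w) phi 0 j.
    apply: contrapT => nj; case/eqP: wE; apply/rowP => j.
    by apply/eqP/negPn/negP => wj; apply: nj; exists j.
  have c1 : (p : PT).2 0 j - pol (sq p.2) p.1 0 j @[p --> (phi, w)] -->
      w 0 j - pol (sq w) phi 0 j.
    have d1 : (p : PT).2 0 j @[p --> (phi, w)] --> w 0 j.
      exact: cvg_comp (@cvg_snd _ _ (nbhs phi) (nbhs w) _)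
        (@coord_continuous _ _ _ 0 j w).
    have d2 : pol (sq (p : PT).2) p.1 0 j @[p --> (phi, w)] -->
        pol (sq w) phi 0 j.
      exact: cvg_comp (@continuous_polar (phi, w))
        (@coord_continuous _ _ _ 0 j _).
    exact: cvgB d1 d2.
  have wj0 : w 0 j - pol (sq w) phi 0 j != 0 by rewrite subr_eq0.
  have nN : \forall p \near (phi, w),
      (p : PT).2 0 j - pol (sq p.2) p.1 0 j != 0.
    exact: (cvgr_neq0 _ c1 wj0).
  apply: (@filterS _ (nbhs (phi, w)) _ _ _ _ nN) => -[phi' w'] /= + wE'.
  by rewrite -wE' subrr eqxx.
have /compact_near_coveringP near_cube := compact_cube.
have nw : \forall w' \near w, cube `<=`
    (fun phi => w' = pol (sq w') phi -> O (unroll (phi, w'))).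
  exact: near_cube near_all.
apply: (@filterS _ (nbhs w) _ _ _ _ nw) => w' Hw' /=.
by apply: Hw'; [exact: (aP w').1 | exact: (aP w').2].
Qed.

(** The quotients by the slack of the waves of [weighted_wave]. *)
Lemma polar_map : exists2 f : toric_orbifold Q lambda -> 'rV[R]_(s + s),
  (forall p, cell_of cface v p -> {for p, continuous f}) &
  forall u (x : set_type Q), inner (set_val x) ->
    f (toric_proj lambda (torus_proj u, x)) =
    pol (r2 (set_val x)) (\row_r ang u (enum_val r)).
Proof.
pose is_wave (c : R -> R) (r : 'I_s) (h : toric_orbifold Q lambda -> R) :=
  continuous h /\ forall u (x : set_type Q),
    h (toric_proj lambda (torus_proj u, x)) = sl (set_val x) *
      (md (set_val x) (enum_val r) * c (turn * ang u (enum_val r))).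
have wave c : continuous c ->
    (forall a (z : int), c (a + turn * z%:~R) = c a) ->
    {h & forall r, is_wave c r (h r)}.
  move=> cc_ cper; apply: choice => r; rewrite /is_wave.
  by have [h ch hE] := weighted_wave (enum_valP r) cc_ cper; exists h.
have [hc hcE] := wave _ (@continuous_cos R) (@cosD2pi_int R).
have [hs hsE] := wave _ (@continuous_sin R) (@sinD2pi_int R).
have [||hl chl hlE] := @continuous_toric_lift R n Q lambda _
    (fun p => sl (set_val p.2)) => //.
  move=> p; have valc : continuous (set_val : set_type Q -> 'rV[R]_n).
    exact: initial_continuous.
  exact: cvg_comp (cvg_comp _ _ (@cvg_snd _ _ (nbhs p.1) (nbhs p.2) _) (valc _))
    (@continuous_slack _).
pose f p : 'rV[R]_(s + s) :=
  row_mx (\row_r (hc r p / hl p)) (\row_r (hs r p / hl p)).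
exists f => [p|u x inx].
  move=> /cell_of_proj[u [x [-> inx Ix]]]; set q := toric_proj _ _.
  have slq : hl q != 0 by rewrite hlE; exact/(slack_neq0 inx.1).
  have clV : (hl q')^-1 @[q' --> q] --> (hl q)^-1 by exact: cvgV slq (chl q).
  have fcos (r : 'I_s) q' : f q' 0 (lshift s r) = hc r q' / hl q'.
    by rewrite row_mxEl mxE.
  have fsin (r : 'I_s) q' : f q' 0 (rshift s r) = hs r q' / hl q'.
    by rewrite row_mxEr mxE.
  apply: continuous_rV => j; rewrite -(splitK j).
  case: (fintype.split j) => r /=.
    rewrite fcos; under eq_cvg do rewrite fcos.
    exact: cvgM ((hcE r).1 q) clV.
  rewrite fsin; under eq_cvg do rewrite fsin.
  exact: cvgM ((hsE r).1 q) clV.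
have sx := (slack_neq0 inx.1).2 inx.
congr row_mx; apply/rowP => r;
  rewrite [LHS]mxE [RHS]mxE [(\row_r0 ang _ _) 0 r]mxE hlE/=.
  by rewrite (hcE r).2 mulrAC mulfV// mul1r.
by rewrite (hsE r).2 mulrAC mulfV// mul1r.
Qed.

Lemma cell_homeomorphic_disc :
  homeomorphic (cell_of cface v) (@open_disc R (s + s)).
Proof.
have [f cf fE] := polar_map.
pose angles w phi := cube phi /\ w = pol (sq w) phi.
have [a aP] : {a & forall w, angles w (a w)}.
  apply: choice => w; have [phi H1 H2] := exists_polar w.
  by exists phi; split=> // r; rewrite /= in_itv.
have sq_pol x phi : inner x -> cface x -> sq (pol (r2 x) phi) = r2 x.
  move=> [Qx _] [_ xI]; apply: sqnorms_polar => i; first exact: radius2_ge0.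
  by move=> /xI/radius2_coord0.
exists f, (fun w => unroll (a w, w)); split.
- move=> p /cell_of_proj[u [x [-> inx Ix]]].
  rewrite fE// /open_disc /= -taxicab_sqnorms sq_pol// taxicab_radius2.
  have [Qx Lx] := inx; apply/corner_gauge_lt1 => j.
  by rewrite absvE// => i; exact: (coord_ge0 chartQ).
- move=> w w1; have [inx Ix _] := disc_base_star w1.
  by rewrite /cell_of /= /unroll toric_repr_base; apply/open_star_inner.
- split=> [p /cell_of_proj[u [x [-> inx Ix]]]|w w1].
    rewrite fE//; set w := pol _ _.
    have sqw : sq w = r2 (set_val x) by exact: sq_pol.
    apply/esym/toric_proj_eq; split.
      by apply/val_inj; rewrite /= (disc_base_radius2 _ _ sqw).
    apply: polar_collision => //; rewrite -sqw.
    have [_ {1}<-] := aP w.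
    by rewrite sqw.
  have [inx _ rE] := disc_base_star w1.
  rewrite /unroll fE//= rE [RHS](aP w).2; congr polar.
  by apply/rowP => r; rewrite mxE angle_liftE.
- by apply: continuous_in_subspaceT => p; rewrite inE => /cf.
- apply: continuous_in_subspaceT => w; rewrite inE => w1.
  exact: continuous_unroll_angles.
Qed.

End Cell.

(** * Faces *)

Section Faces.
Context {R : realType} {n : nat}.
Implicit Types (Q P F G : set 'rV[R]_n) (x v : 'rV[R]_n).

Lemma face_sub Q F : face Q F -> F `<=` Q.
Proof. by move=> [_ [c [b [_ ->]]]] x []. Qed.

Lemma face_self Q : Q !=set0 -> face Q Q.
Proof.
move=> Q0; split=> //; exists 0, 0; split=> [x _|]; first by rewrite dotv0l.
by apply/seteqP; split=> [x Qx|x []//]; split=> //=; rewrite dotv0l.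
Qed.

Lemma face_setI Q F G : face Q F -> face Q G -> F `&` G !=set0 ->
  face Q (F `&` G).
Proof.
move=> [_ [c [b [cb FE]]]] [_ [d [a [da GE]]]] FG0; split=> //.
exists (c + d), (b + a); split=> [x Qx|]; first by rewrite dotvDl lerD ?cb ?da.
apply/seteqP; split=> x.
  rewrite FE GE => -[[Qx /= cx] [_ /= dx]].
  by split=> //=; rewrite dotvDl cx dx.
move=> [Qx /=]; rewrite dotvDl => cdx.
have := cb x Qx; have := da x Qx => dx cx.
by rewrite FE GE; split; split=> //=; lra.
Qed.

Lemma vertices_face Q F v : vertices Q v -> face Q F ->
  vertices F v <-> F v.
Proof.
move=> [_ [c [b [cb vE]]]] fF; split=> [|Fv]; first exact: vertex_in.
have [_ /= cv] : (Q `&` [set x | dotv c x = b]) v by rewrite -vE.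
split; first by exists v.
exists c, b; split=> [x /(face_sub fF)/cb//|].
apply/seteqP; split=> x; first by move=> /= ->; split.
by move=> [Fx cx]; rewrite vE; split=> //; exact: face_sub Fx.
Qed.

Lemma face_convex Q F v x (t : R) : polytope Q -> face Q F -> F v -> F x ->
  0 <= t <= 1 -> F (v + t *: (x - v)).
Proof.
move=> [_ [k [N [b QE]]]] [_ [c [a [_ FE]]]]; rewrite FE QE.
move=> [Qv /= cv] [Qx /= cx] t01; split=> [j|/=]; last first.
  by rewrite dotvDr dotvZr dotvBr cv cx subrr mulr0 addr0.
by rewrite dotvDr dotvZr dotvBr; have := Qv j; have := Qx j; nra.
Qed.

(** Every point of [F] lies on a segment from [v] whose beginning is in [P],
    hence in the hyperplane that cuts out [P]. *)
Lemma face_near_sub Q F P v :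
  polytope Q -> face Q F -> face Q P -> F v -> P v ->
  within F (nbhs v) P -> F `<=` P.
Proof.
move=> polyQ fF fP Fv Pv nearP x Fx.
have Qx := face_sub fF Fx.
have path_cont : v + t *: (x - v) @[t --> (0 : R)] --> v + 0 *: (x - v).
  exact: cvgD (@cvg_cst _ v _ (nbhs (0 : R)) _)
    (cvgZ (@cvg_id _ (nbhs (0 : R))) (@cvg_cst _ (x - v) _ (nbhs (0 : R)) _)).
have : \forall t \near (0 : R), F (v + t *: (x - v)) -> P (v + t *: (x - v)).
  have nearP' : nbhs (v + (0 : R) *: (x - v)) [set y | F y -> P y].
    by rewrite scale0r addr0.
  exact: path_cont _ nearP'.
move=> /nbhs_ballP[e /= e0 He].
pose t := Num.min (e / 2) 1.
have t0 : 0 < t by rewrite lt_min divr_gt0// ltr01.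
have te : t < e by rewrite gt_min ltr_pdivrMr// ltr_pMr// ltr1n.
have t1 : t <= 1 by rewrite ge_min lexx orbT.
have : P (v + t *: (x - v)).
  apply: He; first by rewrite /ball /= sub0r normrN gtr0_norm.
  by apply: (face_convex polyQ) => //; rewrite ltW.
case: fP Pv => _ [c [b [_ ->]]] [_ /= cv] [_ /=].
rewrite dotvDr dotvZr dotvBr cv => /eqP.
rewrite -subr_eq0 addrAC subrr add0r mulf_eq0 gt_eqF//= subr_eq0 => /eqP cx.
by split.
Qed.

End Faces.

(** * Open stars with trivial local group *)

Section StarsAreDiscs.
Context {R : realType} {n : nat}.
Variables (Q : set 'rV[R]_n) (lambda : set 'rV[R]_n -> 'rV[int]_n).
Hypotheses (simpleQ : simple_polytope Q).
Hypothesis charQ : characteristic_function Q lambda.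

Lemma face_vertex_chart (P : set 'rV[R]_n) v :
  vertices Q v -> face Q P -> P v ->
  exists (D : 'M[R]_n) k (L : 'I_k -> 'rV[R]_n) (I : {set 'I_n}),
    vertex_chart Q v D L /\ P = coord_face Q v D I.
Proof.
move=> vv fP Pv; have [D [k [L chartQ]]] := exists_vertex_chart simpleQ vv.
have fP' : face (coord_face Q v D [set: 'I_n]%SET) P by rewrite coord_faceT.
by have [I _ PE] := face_coord_face chartQ fP' Pv; exists D, k, L, I.
Qed.

(** The lattice of a vertex is 0, as the characteristic vectors of the facets
    through it span the whole space. *)
Lemma vertex_local_group v : vertices Q v ->
  forall g : local_group Q lambda [set v] v, g = 0.
Proof.
move=> vv; have [D [k [L [I [chartQ vE]]]]] := face_vertex_chart vv vv erefl.
have I0 i : i \notin I.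
  apply/negP => iI; have [e e0 Qe] := edge_vectors chartQ.
  have : coord_face Q v D I (point v D (e *: delta_mx 0 i)).
    exact: (coord_face_edge chartQ (Qe i)).
  rewrite -vE => /= /(congr1 (coord v D)); rewrite (pointK chartQ) coord_vertex.
  move=> /rowP/(_ i); rewrite !mxE !eqxx mulr1 => e00.
  by rewrite e00 ltxx in e0.
move=> g; have [q <-] := quotient_proj_surj g.
have [z <-] := quotient_proj_surj q.
rewrite -(quotient_proj0 (lambda_face Q lambda [set v] @` _)).
congr quotient_proj.
rewrite -(quotient_proj0 (M_star Q lambda [set v])); apply/quotient_proj_eq.
apply: sub_gen_subgroup; rewrite subr0 /M_star /= vE.
by apply/(M_real_coord_face chartQ charQ) => i; rewrite (negbTE (I0 i)).
Qed.

Lemma star_homeomorphic_disc P v : vertices Q v -> face Q P -> P v ->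
  (forall g : local_group Q lambda P v, g = 0) ->
  exists d, homeomorphic (@cell_of R n Q lambda P v) (@open_disc R d).
Proof.
move=> vv fP Pv; have [D [k [L [I [chartQ PE]]]]] := face_vertex_chart vv fP Pv.
rewrite PE in fP * => triv.
have [[bQ _] _ _] := simpleQ.
have [K HK] := chart_corner_bounded chartQ bQ.
have [m [m0 mint mdual]] := angular_coordinates chartQ charQ triv.
exists (#|I| + #|I|)%N.
have gaugeL := corner_gauge_radial HK.
exact: (cell_homeomorphic_disc chartQ charQ gaugeL fP m0 mint mdual).
Qed.

End StarsAreDiscs.

Lemma cell_of_invariant {R : realType} {n : nat} (Q : set 'rV[R]_n)
    (lambda : set 'rV[R]_n -> 'rV[int]_n) (P : set 'rV[R]_n) v :
  Defs.invariant (@cell_of R n Q lambda P v).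
Proof.
move=> t p; rewrite /cell_of /=; rewrite -{2}(toric_reprK p).
by case: (toric_repr p) => s x /=; rewrite torus_actE toric_repr_base.
Qed.

(** * Retraction sequences *)

Section RetractionSequences.
Context {R : realType} {n : nat}.
Variables (Q : set 'rV[R]_n) (m : nat) (B P : nat -> set 'rV[R]_n).
Variable (v : nat -> 'rV[R]_n).
Hypotheses (polyQ : polytope Q) (seqQ : retraction_sequence Q m B P v).
Local Notation star i := (open_star Q (P i) (v i)).

Lemma retraction_start : [/\ B 1%N = Q, P 1%N = Q & vertices Q (v 1%N)].
Proof. exact: retr_start seqQ. Qed.

Lemma retraction_length : (0 < m)%N.
Proof.
have [_ _ v1] := retraction_start; rewrite lt0n; apply/eqP => m0.
have := retr_card seqQ; rewrite m0 II0 card_eq0 => /eqP v0.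
by have : vertices Q (v 1%N) by []; rewrite v0.
Qed.

Lemma retraction_stage i : (0 < i <= m)%N ->
  [/\ vertices Q (v i), face Q (P i), P i (v i), P i `<=` B i
    & forall F, faces_of Q (B i) F -> F (v i) -> F `<=` P i].
Proof.
case: i => [//|[|i]] im.
  have [B1 P1 v1] := retraction_start.
  have Qv := vertex_in v1.
  rewrite P1 B1; split=> //; first by apply: face_self; exists (v 1%N).
  by move=> F [fF FQ] _.
have [U [s [[[Bv vv] [UB nU] _ _] [[fP PB] UP] _ _]]] :=
  retr_P seqQ (k := i.+2) im.
have Uv : U (v i.+2) by exact: (nbhs_singleton nU).
split=> //; first exact: UP.
move=> F [fF FB] Fv; apply: (face_near_sub polyQ fF fP Fv (UP _ Uv)).
by apply: (@filterS _ (nbhs (v i.+2)) _ _ _ _ nU) => x BU Fx; apply/UP/BU/FB.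
Qed.

Lemma retraction_cover i x : (0 < i <= m)%N -> B i x ->
  exists2 F, faces_of Q (B i) F & F x.
Proof.
case: i => [//|[|i]] im.
  have [B1 _ _] := retraction_start.
  rewrite B1 => Qx; exists Q => //; split=> //; apply: face_self; by exists x.
rewrite (retr_B seqQ (k := i.+2) im) => -[F [[fF FB] nvF] Fx]; exists F => //.
by split=> // y Fy; exists F.
Qed.

(** Going from [B i] to [B i.+1] removes exactly the open star of [v i] in [P
    i]: the faces of [B i] through [v i] are in [P i], because [P i] contains
    a neighbourhood of [v i] in [B i]. *)
Lemma retraction_next i : (0 < i < m)%N ->
  B i.+1 `<=` B i /\ forall x, star i x <-> B i x /\ ~ B i.+1 x.
Proof.
move=> /andP[i0 im]; have im' : (0 < i <= m)%N by rewrite i0 ltnW.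
have [vv fP Pv PB FP] := retraction_stage im'.
have Bi := retr_B seqQ (k := i.+1) _; rewrite ltnS i0 im /= in Bi.
rewrite (Bi isT); split=> [x [F [[_ FB] _] /FB]//|x]; split.
  move=> [Px nF]; split; first exact: PB.
  move=> [F [[fF FB] nvF] Fx]; apply: nF; exists (F `&` P i) => //.
  split; first by apply: face_setI => //; exists x.
  split; first by move=> ? [].
  by move=> [Fv _]; apply: nvF; apply/(vertices_face vv fF).
move=> [Bx nB]; have [F [fF FB] Fx] := retraction_cover im' Bx.
have Fv : F (v i).
  apply: contrapT => nFv; apply: nB; exists F => //; split=> //.
  by apply: contra_not nFv => /(vertices_face vv fF).
split; first exact: (FP F).
move=> [G [fG [GP nGv]] Gx]; apply: nB; exists G => //; split.
  by split=> // y /GP/PB.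
by apply: contra_not nGv => /(vertices_face vv fG).
Qed.

Lemma retraction_last x : star m x <-> B m x.
Proof.
have [-> PE] := retr_end seqQ; rewrite PE; split=> [[]//|->]; split=> //.
by move=> [F [_ [_ nFv]] /nFv].
Qed.

Lemma retraction_decreasing i j : (0 < i <= j)%N -> (j <= m)%N -> B j `<=` B i.
Proof.
move=> /andP[i0]; elim: j => [|j IH]; first by rewrite leqNgt i0.
rewrite leq_eqVlt => /orP[/eqP-> _|ij jm]; first exact: subset_refl.
have [BB _] : B j.+1 `<=` B j /\ forall x, star j x <-> B j x /\ ~ B j.+1 x.
  by apply: retraction_next; rewrite jm (leq_trans i0 ij).
by apply: subset_trans BB (IH ij (ltnW jm)).
Qed.

Lemma star_disjoint i j x : (0 < i)%N -> (i < j)%N -> (j <= m)%N ->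
  star i x -> star j x -> False.
Proof.
move=> i0 ij jm; have im : (0 < i < m)%N by rewrite i0 (leq_trans ij jm).
have [_ starE] := retraction_next im; move=> /starE[_ nB] [Px _]; apply: nB.
apply: (@retraction_decreasing i.+1 j) => //.
have [//|_ _ _ PB _] := @retraction_stage j; first by rewrite (leq_trans _ ij).
exact: PB.
Qed.

Lemma star_cover x : Q x -> exists i : 'I_m, star i.+1 x.
Proof.
move=> Qx; have m0 := retraction_length.
suff H k : (k < m)%N -> B k.+1 x \/ exists i : 'I_m, star i.+1 x.
  have [|Bm|//] := H m.-1; first by rewrite prednK.
  have ml : (m.-1 < m)%N by rewrite prednK.
  exists (Ordinal ml) => /=; rewrite prednK//; apply/retraction_last.
  by move: Bm; rewrite prednK.
elim: k => [_|k IH km].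
  by left; have [-> _ _] := retraction_start.
have [Bk|] := IH (ltnW km); last by right.
have [_ starE] := @retraction_next k.+1 km.
have [Bk1|nB] := pselect (B k.+2 x); first by left.
by right; exists (Ordinal (ltnW km)); apply/starE.
Qed.

End RetractionSequences.

(** * The cell structure *)

Theorem lemma2p8 (R : realType) (n : nat) (Q : set 'rV[R]_n)
    (lambda : set 'rV[R]_n -> 'rV[int]_n)
    (hQ : simple_polytope Q) (hlambda : characteristic_function Q lambda)
    (hretr : retractable Q lambda) :
  invariant_cell_structure Q lambda.
Proof.
have [polyQ _ _] := hQ; have [m [B [P [v [seqQ triv]]]]] := hretr.
exists m, (fun i : 'I_m => @cell_of R n Q lambda (P i.+1) (v i.+1)); split.
- by move=> i; exact: cell_of_invariant.
- move=> i; have im : (0 < i.+1 <= m)%N by exact: ltn_ord.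
  have [vv fP Pv _ _] := retraction_stage polyQ seqQ im.
  apply: star_homeomorphic_disc => //.
  have [im'|] := ltnP i.+1 m; first exact: triv.
  move=> mi; have -> : i.+1 = m by apply/eqP; rewrite eqn_leq mi ltn_ord.
  have [_ ->] := retr_end seqQ.
  apply: vertex_local_group => //.
  by move: vv; have -> : i.+1 = m by apply/eqP; rewrite eqn_leq mi ltn_ord.
- move=> i j _ _ [p [ip jp]]; apply/val_inj/eqP.
  have [ij|ji|//] := ltngtP i j; exfalso.
    exact: (star_disjoint polyQ seqQ _ _ (ltn_ord j) ip jp).
  exact: (star_disjoint polyQ seqQ _ _ (ltn_ord i) jp ip).
- apply/seteqP; split=> // p _.
  have [i pi] := star_cover polyQ seqQ (set_valP (toric_repr p).2).
  by exists i.
Qed.
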